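(* Let $q\in\mathbb{R}[x]$ be a monic quartic polynomial which is indefinite and has no multiple roots, and let $C$ be the affine curve $y^2+q(x)=0$ over $\mathbb{R}$. There is an integer $N\ge1$ such that $$\theta(f)\le N+\Bigl\lceil\tfrac12\delta(f)\Bigr\rceil$$ holds for every psd $f\in\mathbb{R}[C]$.
   Context: $\mathbb{R}[C]=\mathbb{R}[x,y]/(y^2+q(x))$. Indefinite means $q$ takes both positive and negative values on $\mathbb{R}$. The nonsingular projective model of $C$ has exactly two points at infinity, a complex conjugate pair $\infty,\overline\infty$. For $f\in\mathbb{R}(C)^*$ put $\delta(f)=-v_\infty(f)$ ($v_\infty$ the discrete valuation at $\infty$), $\delta(0)=-\infty$; for $f=a(x)+b(x)y$ with $a,b\in\mathbb{R}[x]$, $\delta(f)=\max\{\deg a,\deg b+2\}$. An element $f\in\mathbb{R}[C]$ is psd if $f(p)\ge0$ for all $p\in C(\mathbb{R})$. For $0\ne f\in\mathbb{R}[C]$, $\theta(f)$ is the least integer $d\ge0$ such that $f=f_1^2+\cdots+f_r^2$ for some $r\in\mathbb{N}$ and $f_i\in\mathbb{R}[C]$ with $\delta(f_i)\le d$ for all $i$; $\theta(f)=\infty$ if no such representation exists. *)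

(* Defs.v *)
From Stdlib Require Import Reals List Arith.
Open Scope R_scope.

(* Real polynomials as coefficient lists, lowest degree first
   (trailing zeros allowed; equality is coefficientwise). *)
Definition rpoly := list R.
Definition coef (p : rpoly) (i : nat) : R := nth i p 0.
Definition peq (p r : rpoly) : Prop := forall i, coef p i = coef r i.

Fixpoint peval (p : rpoly) (x : R) : R :=
  match p with nil => 0 | c :: p' => c + x * peval p' x end.

Fixpoint padd (p r : rpoly) : rpoly :=
  match p, r with
  | nil, _ => r
  | _, nil => p
  | a :: p', b :: r' => (a + b) :: padd p' r'
  end.

Definition pscale (c : R) (p : rpoly) : rpoly := map (Rmult c) p.
Definition popp (p : rpoly) : rpoly := map Ropp p.

Fixpoint pmul (p r : rpoly) : rpoly :=
  match p with
  | nil => nil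
  | a :: p' => padd (pscale a r) (0 :: pmul p' r)
  end.

(* degree; None stands for deg 0 = -infinity *)
Fixpoint pdeg (p : rpoly) : option nat :=
  match p with
  | nil => None
  | c :: p' =>
      match pdeg p' with
      | Some n => Some (S n)
      | None => if Req_EM_T c 0 then None else Some O
      end
  end.

Fixpoint pderiv_aux (n : nat) (p : rpoly) : rpoly :=
  match p with nil => nil | c :: p' => (INR n * c) :: pderiv_aux (S n) p' end.
Definition pderiv (p : rpoly) : rpoly :=
  match p with nil => nil | _ :: p' => pderiv_aux 1 p' end.

Definition cplx := (R * R)%type.
Definition zadd (z w : cplx) : cplx := (fst z + fst w, snd z + snd w).
Definition zmul (z w : cplx) : cplx :=
  (fst z * fst w - snd z * snd w, fst z * snd w + snd z * fst w).
Fixpoint pevalC (p : rpoly) (z : cplx) : cplx :=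
  match p with nil => (0, 0) | c :: p' => zadd (c, 0) (zmul z (pevalC p' z)) end.


Definition monic_quartic (q : rpoly) : Prop := length q = 5%nat /\ coef q 4 = 1.

Definition indefinite (q : rpoly) : Prop :=
  (exists x, 0 < peval q x) /\ (exists x, peval q x < 0).

Definition no_multiple_roots (q : rpoly) : Prop :=
  forall z : cplx, ~ (pevalC q z = (0, 0) /\ pevalC (pderiv q) z = (0, 0)).

(* Coordinate ring R[C] = R[x,y]/(y^2+q(x)): elements written uniquely as
   a(x) + b(x) y, represented by the pair (a, b). *)
Definition CR := (rpoly * rpoly)%type.
Definition ceq (f g : CR) : Prop := peq (fst f) (fst g) /\ peq (snd f) (snd g).
Definition cadd (f g : CR) : CR := (padd (fst f) (fst g), padd (snd f) (snd g)).
(* (a + b y)(c + d y) = (ac - bd q) + (ad + bc) y  since y^2 = -q *)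
Definition cmul (q : rpoly) (f g : CR) : CR :=
  (padd (pmul (fst f) (fst g)) (popp (pmul (pmul (snd f) (snd g)) q)),
   padd (pmul (fst f) (snd g)) (pmul (snd f) (fst g))).
Definition czero : CR := (nil, nil).

Definition sum_sq (q : rpoly) (l : list CR) : CR :=
  fold_right (fun g acc => cadd (cmul q g g) acc) czero l.

Definition ceval (f : CR) (x y : R) : R := peval (fst f) x + peval (snd f) x * y.

Definition psd (q : rpoly) (f : CR) : Prop :=
  forall x y : R, y * y + peval q x = 0 -> 0 <= ceval f x y.

Definition omax (a b : option nat) : option nat :=
  match a, b with
  | None, _ => b
  | _, None => a
  | Some m, Some n => Some (Nat.max m n)
  end.

Definition delta (f : CR) : option nat :=
  omax (pdeg (fst f)) (option_map (fun n => (n + 2)%nat) (pdeg (snd f))).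

Definition delta_le (f : CR) (d : nat) : Prop :=
  match delta f with None => True | Some e => (e <= d)%nat end.

(* f is a sum of squares of elements g with delta(g) <= d;
   theta(f) <= d  iff  sos_bound q f d *)
Definition sos_bound (q : rpoly) (f : CR) (d : nat) : Prop :=
  exists l : list CR, Forall (fun g => delta_le g d) l /\ ceq f (sum_sq q l).

(* Main.v *)
(** Write [|f + h y|^2] for the product of [f + h y], with [f], [h] complex
    polynomials, by its complex conjugate. Let [F = a + b y] be psd with
    [delta F = d]. After dividing out squares and factors [(x - z)(x - conj z)],
    the zeros of [F] split into a set [D] and its conjugate. Counting dimensions
    gives a nonzero [H = f + h y] with [delta H <= d/2 + 1] that vanishes on [D]
    (and, if [d] is even, has a smaller pole at one point at infinity). Hence [F]
    divides [|H|^2], and the quotient [c] has [delta c <= 1], so it is a polynomial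
    of degree at most 1 in [x], nonnegative on [C].

    Let [r] and [r'] be the least and the greatest real root of [q]. There are
    nonnegative polynomials [w], [w'] with [x - r + q w] and [r' - x + q w'] both
    nonnegative, so [c = S0 - q S1] with [S0], [S1] nonnegative of degree bounded in
    terms of [q] alone. Thus [c] is a sum of terms [|kj|^2], [kj = pj + i bj y],
    and after rotating [(p1, p2)] each [H kj] is divisible by [c]; therefore
    [F = sum |H kj / c|^2], whose real and imaginary parts are the required squares. *)
Require Import Defs.
From Stdlib Require Import Reals List Arith.
From HB Require structures.
From mathcomp Require all_boot all_order all_algebra.
From mathcomp Require complex polyrcf Rstruct zify ring lra.

(* MathComp is imported inside a module because its notations would change the
   meaning of [<=] and [+] in the theorem. *)
Module PsdOnCurve.
Import HB.structures.
Import all_boot all_order all_algebra complex polyrcf Rstruct zify ring lra.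

Set Implicit Arguments.
Unset Strict Implicit.
Unset Printing Implicit Defensive.
Import Order.TTheory GRing.Theory Num.Theory.
Local Open Scope ring_scope.

(** * Real polynomials near the region [q <= 0] *)

Section RealPolynomials.
Variable R : rcfType.
Implicit Types (p q s : {poly R}) (x y r : R).

Lemma poly_neg_nbhs p x : p.[x] < 0 ->
  exists2 e, 0 < e & forall y, `|y - x| < e -> p.[y] < 0.
Proof.
move=> px; have Np : 0 < - p.[x] by rewrite oppr_gt0.
have [e e0 He] := poly_cont x p Np; exists e => // y /He; rewrite ltr_norml.
by case/andP=> _; lra.
Qed.

Lemma poly_nonroot_between s (a b : R) : s != 0 -> a < b ->
  exists2 t, a < t < b & s.[t] != 0.
Proof.
(* The first [size s] values of [f] are distinct points of the interval, one more than a nonzero [s]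
   can have as roots. *)
move=> s0 ab; pose f (k : nat) := a + (b - a) / (k.+2)%:R.
have fI : injective f.
  move=> i j /addrI /(mulfI _) Hij.
  have /Hij /invr_inj /eqP : b - a != 0 by rewrite subr_eq0 gt_eqF.
  by rewrite eqr_nat => /eqP [].
have fb k : a < f k < b.
  rewrite /f -ltrBlDl subrr divr_gt0 ?subr_gt0 ?ltr0n //=.
  rewrite -ltrBrDl ltr_pdivrMr ?ltr0n // ltr_pMr ?subr_gt0 //.
  by rewrite ltr1n.
pose l := [seq f k | k <- iota 0 (size s)].
case: (boolP (all (root s) l)) => [Hl|/allPn [t /mapP [k _ ->]] H].
  have := max_poly_roots s0 Hl; rewrite map_inj_uniq ?iota_uniq // => /(_ isT).
  by rewrite size_map size_iota ltnn.
by exists (f k).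
Qed.

Definition simple_real_roots q := forall x, root q x -> ~~ root q^`() x.

Lemma deriv_mulXsub q r : (('X - r%:P) * q)^`().[r] = q.[r].
Proof. by rewrite derivM derivXsubC mul1r !hornerE subrr mul0r addr0. Qed.

(* At a simple root [q] changes sign, so the region [q <= 0] has no isolated point. *)
Lemma nonpos_region_half_nbhs q x : simple_real_roots q -> q.[x] <= 0 ->
  exists (a b : R), [/\ a < b, a = x \/ b = x & forall y, a < y < b -> q.[y] <= 0].
Proof.
move=> qS; rewrite le_eqVlt => /orP [/eqP qx|qx].
  have rx : root q x by apply/eqP.
  have := qS x rx; have /factor_theorem [q1 def_q] := rx.
  rewrite def_q mulrC rootE deriv_mulXsub => q1x.
  have [q1n|q1p] : q1.[x] < 0 \/ (- q1).[x] < 0.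
    by rewrite hornerN oppr_lt0; case: (ltrgtP q1.[x] 0) q1x; auto.
  - have [e e0 He] := poly_neg_nbhs q1n.
    exists x, (x + e); split; [by lra|by left|move=> y /andP[y1 y2]].
    rewrite !hornerE; have : q1.[y] < 0 by apply: He; rewrite ger0_norm; lra.
    by nra.
  - have [e e0 He] := poly_neg_nbhs q1p.
    exists (x - e), x; split; [by lra|by right|move=> y /andP[y1 y2]].
    rewrite !hornerE; have : (- q1).[y] < 0 by apply: He; rewrite ler0_norm; lra.
    by rewrite hornerN; nra.
have [e e0 He] := poly_neg_nbhs qx.
exists x, (x + e); split; [by lra|by left|move=> y /andP[y1 y2]].
by apply/ltW/He; rewrite ger0_norm; lra.
Qed.

(** The half-interval at [x] inside the region [q <= 0], cut down to where [p < 0], is still a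
    nonempty open interval, so it contains a point missed by the finitely many roots of [s]. *)
Lemma nonpos_region_dense q p s x : simple_real_roots q -> s != 0 ->
  q.[x] <= 0 -> p.[x] < 0 ->
  exists y, [/\ q.[y] <= 0, p.[y] < 0 & s.[y] != 0].
Proof.
move=> qS s0 qx px; have [e e0 He] := poly_neg_nbhs px.
have [a [b [ab abx Hab]]] := nonpos_region_half_nbhs qS qx.
have : Num.max a (x - e) < Num.min b (x + e).
  by rewrite lt_min !gt_max; case: abx => ?; subst; apply/andP; split;
    apply/andP; split; lra.
case/(poly_nonroot_between s0) => t; rewrite gt_max lt_min.
case/andP=> /andP [t1 t2] /andP [t3 t4] st.
exists t; split=> //; first by apply: Hab; rewrite t1 t3.
by apply: He; rewrite ltr_norml; apply/andP; split; lra.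
Qed.

Lemma nonneg_on_region_cancel q p s : simple_real_roots q -> s != 0 ->
  (forall x, q.[x] <= 0 -> 0 <= (s ^+ 2 * p).[x]) ->
  forall x, q.[x] <= 0 -> 0 <= p.[x].
Proof.
move=> qS s0 H x qx; rewrite leNgt; apply/negP => px.
have [y [qy py sy]] := nonpos_region_dense qS s0 qx px.
have := H y qy; rewrite hornerM horner_exp.
have : 0 < s.[y] ^+ 2 by rewrite exprn_even_gt0.
by nra.
Qed.

(** With [q := -1] the region [q <= 0] is the whole line, so the lemmas on the region specialise to
    all of [R]. *)
Lemma simple_real_rootsN1 : simple_real_roots (-1).
Proof. by move=> x; rewrite /root hornerN hornerC oppr_eq0 oner_eq0. Qed.

Lemma nonneg_cancel p s : s != 0 ->
  (forall x, 0 <= (s ^+ 2 * p).[x]) -> forall x, 0 <= p.[x].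
Proof.
move=> s0 H x; apply: (nonneg_on_region_cancel simple_real_rootsN1 s0) => //.
by rewrite !hornerE; lra.
Qed.

(** The factor ['X - r%:P] changes sign at [r] while [q < 0] on both sides; a nonzero [p.[r]] would
    keep its sign there and make the product negative on one side. *)
Lemma root_of_sign_change q p r : q.[r] < 0 ->
  (forall x, q.[x] <= 0 -> 0 <= (('X - r%:P) * p).[x]) -> root p r.
Proof.
move=> qr H; have [e e0 He] := poly_neg_nbhs qr.
rewrite rootE; case: (ltrgtP p.[r] 0) => // pr.
- have [d d0 Hd] := poly_neg_nbhs pr.
  set m := Num.min e d / 2.
  have [m0 [m1 m2]] : 0 < m /\ m < e /\ m < d.
    by rewrite /m; case: (ltP e d) => ?; lra.
  have A : `|r + m - r| = m by rewrite addrC addKr gtr0_norm.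
  have := H (r + m) (ltW (He _ _)); rewrite A => /(_ m1).
  have := Hd (r + m); rewrite A !hornerE => /(_ m2); nra.
- have {}pr : (- p).[r] < 0 by rewrite hornerN oppr_lt0.
  have [d d0 Hd] := poly_neg_nbhs pr.
  set m := Num.min e d / 2.
  have [m0 [m1 m2]] : 0 < m /\ m < e /\ m < d.
    by rewrite /m; case: (ltP e d) => ?; lra.
  have A : `|r - m - r| = m by rewrite addrC addKr normrN gtr0_norm.
  have := H (r - m) (ltW (He _ _)); rewrite A => /(_ m1).
  have := Hd (r - m); rewrite A !hornerE => /(_ m2); nra.
Qed.

End RealPolynomials.

(** * Complex polynomials and sums of two squares *)

Section ComplexPolynomials.
Variable R : rcfType.
Implicit Types (p q u v : {poly R}) (x y r : R).

Definition toC p : {poly R[i]} := map_poly (real_complex R) p.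
Definition iP : {poly R[i]} := ('i%C)%:P.
Definition cpoly u v : {poly R[i]} := toC u + iP * toC v.

Lemma toCD p q : toC (p + q) = toC p + toC q. Proof. exact: rmorphD. Qed.
Lemma toCN p : toC (- p) = - toC p. Proof. exact: rmorphN. Qed.
Lemma toCM p q : toC (p * q) = toC p * toC q. Proof. exact: rmorphM. Qed.
Lemma toCX p n : toC (p ^+ n) = toC p ^+ n. Proof. exact: rmorphXn. Qed.
Definition toCE := (toCD, toCN, toCM, toCX).

Lemma iP2 : iP ^+ 2 = -1.
Proof. by rewrite -rmorphXn /= sqr_i rmorphN1. Qed.

Lemma toC_horner p x : (toC p).[(x%:C)%C] = ((p.[x])%:C)%C.
Proof. exact: horner_map. Qed.

Lemma size_toC p : size (toC p) = size p.
Proof. exact: size_map_poly. Qed.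

Lemma coef_cpoly u v k : (cpoly u v)`_k = Complex u`_k v`_k.
Proof.
rewrite coefD coefCM !coef_map /=; apply/eqP.
by rewrite eq_complex /= !(mul0r, mul1r, subrr, addr0, add0r, subr0) !eqxx.
Qed.

Lemma cpoly_surj (f : {poly R[i]}) : exists u v, f = cpoly u v.
Proof.
exists (\poly_(k < size f) complex.Re f`_k), (\poly_(k < size f) complex.Im f`_k).
apply/polyP => k; rewrite coef_cpoly !coef_poly; case: ltnP => [_|/leq_sizeP H].
  by case: f`_k.
by rewrite H.
Qed.

Lemma cpoly_inj u v u' v' : cpoly u v = cpoly u' v' -> u = u' /\ v = v'.
Proof.
by move=> /polyP H; split; apply/polyP => k; have := H k; rewrite !coef_cpoly => -[].
Qed.

Lemma cpoly_eq0 u v : cpoly u v = 0 -> u = 0 /\ v = 0.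
Proof.
move=> H; apply: cpoly_inj; rewrite H.
by apply/polyP => k; rewrite coef_cpoly !coef0.
Qed.

Lemma size_cpoly_le u v n : (size (cpoly u v) <= n)%N = (size u <= n)%N && (size v <= n)%N.
Proof.
apply/leq_sizeP/andP => [H|[/leq_sizeP Hu /leq_sizeP Hv] j /[dup] /Hu + /Hv].
  by split; apply/leq_sizeP => j /H; rewrite coef_cpoly => -[].
by rewrite coef_cpoly => -> ->.
Qed.

Lemma size_cpolyN u v : size (cpoly u (- v)) = size (cpoly u v).
Proof.
apply/eqP; rewrite eqn_leq size_cpoly_le size_polyN -size_cpoly_le leqnn.
by rewrite size_cpoly_le -(size_polyN v) -size_cpoly_le leqnn.
Qed.

Lemma cpoly_norm u v : toC (u ^+ 2 + v ^+ 2) = cpoly u v * cpoly u (- v).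
Proof.
rewrite /cpoly !toCE; have := iP2.
set a := toC u; set b := toC v; set i := iP => Hi.
have -> : (a + i * b) * (a + i * - b) = a ^+ 2 - i ^+ 2 * b ^+ 2 by ring.
by rewrite Hi mulN1r opprK.
Qed.

Lemma size_quadratic x c : size (('X - x%:P) ^+ 2 + c%:P) = 3%N.
Proof.
by rewrite size_polyDl size_exp_XsubC // (leq_ltn_trans (size_polyC_leq1 _)).
Qed.

(** The remainder of [p] modulo the quadratic is real of degree at most 1 and vanishes at a nonreal
    number; the imaginary part of its value kills the slope, then the real part the constant. *)
Lemma quadratic_dvdp p x y : y != 0 -> root (toC p) (Complex x y) ->
  ('X - x%:P) ^+ 2 + (y ^+ 2)%:P %| p.
Proof.
move=> y0; set m := _ + _.
have sm : size m = 3%N by apply: size_quadratic.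
have m0 : m != 0 by rewrite -size_poly_gt0 sm.
have mz : root (toC m) (Complex x y).
  rewrite rootE /m toCD toCX; apply/eqP.
  rewrite /toC rmorphB /= map_polyX !map_polyC /= !hornerE.
  apply/eqP; rewrite eq_complex /= expr2 /=; apply/andP; split; apply/eqP; ring.
rewrite {1}(divp_eq p m) toCD toCM rootE hornerD hornerM (rootP mz) mulr0 add0r.
rewrite /dvdp; have : (size (p %% m)%R < 3)%N by rewrite (leq_trans (ltn_modpN0 _ m0)) ?sm.
set s := (p %% m)%R; rewrite ltnS => ss.
have -> : s = s`_1 *: 'X + (s`_0)%:P.
  apply/polyP => k; rewrite coefD coefZ coefX coefC.
  case: k => [|[|k]] /=; rewrite ?mulr0 ?mulr1 ?add0r ?addr0 //.
  by apply/(leq_sizeP _ _ ss).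
rewrite toCD /toC map_polyZ map_polyX !map_polyC /= hornerD hornerZ hornerX hornerC.
rewrite eq_complex /= !(mul0r, addr0, subr0) => /andP [/eqP e1 /eqP e2].
have /eqP e3 : s`_1 == 0.
  by move/eqP: e2; rewrite mulf_eq0 (negbTE y0) orbF.
by move: e1; rewrite e3 scale0r mul0r !add0r => ->.
Qed.

(** Induction on the degree. A real root is at least double because [p] does not change sign, and
    its square is pulled out. A nonreal root gives a positive quadratic factor, itself a sum of two
    squares, and such sums are closed under multiplication. *)
Lemma nonneg_sum_two_squares p : (forall x, 0 <= p.[x]) ->
  exists u v, p = u ^+ 2 + v ^+ 2.
Proof.
have [n] := ubnP (size p); elim: n p => // n IHn p; rewrite ltnS => sp Hp.
have [s1|s1] := leqP (size p) 1.
  exists (Num.sqrt p`_0)%:P, 0; have Ep := size1_polyC s1.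
  have p0 : 0 <= p`_0 by move: (Hp 0); rewrite Ep hornerC coefC.
  by rewrite {1}Ep expr0n addr0 -rmorphXn /= sqr_sqrtr.
have p0 : p != 0 by rewrite -size_poly_gt0 (ltn_trans _ s1).
have /closed_rootP [[x y] rz] : size (toC p) != 1.
  by rewrite size_toC gtn_eqF.
have [y0|y0] := eqVneq y 0.
  move: rz; rewrite {}y0 complexr0 rootE toC_horner eq_complex /= eqxx andbT => rz.
  have /factor_theorem [p1 E1] := rz.
  have /factor_theorem [p2 E2] : root p1 x.
    apply: (@root_of_sign_change _ (-1)); first by rewrite !hornerE; lra.
    by move=> t _; rewrite mulrC -E1.
  have X0 : 'X - x%:P != 0 by rewrite polyXsubC_eq0.
  have Ep : p = ('X - x%:P) ^+ 2 * p2 by rewrite E1 E2; ring.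
  have [||u [v Euv]] := IHn p2.
  - apply: leq_trans sp; rewrite Ep size_monicM ?monic_exp ?monicXsubC //.
      by rewrite size_exp_XsubC.
    by apply: contraNneq p0; rewrite Ep => ->; rewrite mulr0.
  - by apply: (nonneg_cancel X0); rewrite -Ep.
  by exists (('X - x%:P) * u), (('X - x%:P) * v); rewrite Ep Euv; ring.
have /dvdpP [p1 Ep] := quadratic_dvdp y0 rz.
set m := _ + _ in Ep.
have mpos t : 0 < m.[t].
  rewrite /m !hornerE /= ltr_wpDl ?sqr_ge0 //.
  by rewrite exprn_even_gt0.
have [||u [v Euv]] := IHn p1.
- apply: leq_trans sp; have p10 : p1 != 0.
    by apply: contraNneq p0; rewrite Ep => ->; rewrite mul0r.
  have m0 : m != 0 by apply/eqP => m0; move: (mpos 0); rewrite m0 horner0 ltxx.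
  by rewrite Ep size_mul // /m size_quadratic addn3 /= leqnSn.
- by move=> t; have := Hp t; rewrite Ep hornerM pmulr_lge0.
exists (('X - x%:P) * u - y%:P * v), (('X - x%:P) * v + y%:P * u).
rewrite Ep Euv /m rmorphXn /=; ring.
Qed.

End ComplexPolynomials.

(** * Degrees and norms *)

(* [lia] compares the canonical structures inside [size p] syntactically. *)
Ltac same_size s t :=
  tryif constr_eq s t then fail else
  (let H := fresh in assert (H : s = t) by reflexivity; clear H;
   change s with t;
   repeat match goal with H : context [s] |- _ => change s with t in H end).
Ltac slia :=
  repeat match goal with
  | |- context [@size ?A ?s] => match goal with
    | |- context [@size ?B ?t] => same_size (@size A s) (@size B t)
    | _ : context [@size ?B ?t] |- _ => same_size (@size A s) (@size B t)
    end
  | _ : context [@size ?A ?s] |- _ => match goal with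
    | _ : context [@size ?B ?t] |- _ => same_size (@size A s) (@size B t)
    end
  end; lia.

Lemma linear_kernel (K : fieldType) m n (f : 'rV[K]_m -> 'rV[K]_n) :
  linear f -> (n < m)%N -> exists2 v, v != 0 & f v = 0.
Proof.
move=> fL nm; pose fLin := GRing.isLinear.Build _ _ _ _ f fL.
pose F : {linear _ -> _} := HB.pack f fLin.
have : kermx (lin1_mx F) != 0.
  rewrite kermx_eq0 /row_free neq_ltn; apply/orP; left.
  exact: leq_ltn_trans (rank_leq_col _) nm.
case/rowV0Pn => v /sub_kermxP vF v0; exists v => //.
by rewrite -[f v]/(F v) -mul_rV_lin1.
Qed.

Section SizeBounds.
Variable F : idomainType.
Implicit Types p r : {poly F}.

Lemma size_mul_bound k l p r :
  (size p <= k.+1)%N -> (size r <= l.+1)%N -> (size (p * r)%R <= (k + l).+1)%N.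
Proof. by move=> Hp Hr; apply: leq_trans (size_polyMleq _ _) _; lia. Qed.

Lemma size_add_bound k p r :
  (size p <= k)%N -> (size r <= k)%N -> (size (p + r)%R <= k)%N.
Proof.
by move=> H1 H2; rewrite (leq_trans (size_polyD _ _)) // geq_max H1.
Qed.

Lemma coef_mul_top k l p r :
  (size p <= k.+1)%N -> (size r <= l.+1)%N -> (p * r)`_(k + l) = p`_k * r`_l.
Proof.
move=> /leq_sizeP Hp /leq_sizeP Hr; rewrite coefM.
have kl : (k < (k + l).+1)%N by lia.
rewrite (bigD1 (Ordinal kl)) //= addKn big1 ?addr0 // => j.
rewrite -val_eqE /= neq_ltn => /orP [jk|kj]; last by rewrite Hp ?mul0r.
by rewrite Hr ?mulr0 //; lia.
Qed.

Lemma size_leq_top k p : (size p <= k.+1)%N -> p`_k = 0 -> (size p <= k)%N.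
Proof.
move=> /leq_sizeP Hp pk; apply/leq_sizeP => j; rewrite leq_eqVlt.
by case/orP=> [/eqP <-|/Hp].
Qed.

Lemma size_XnM k p : p != 0 -> size ('X^k * p) = (k + size p)%N.
Proof. by move=> p0; rewrite size_monicM ?monicXn // size_polyXn. Qed.

End SizeBounds.

Section CoordinateRing.
Variable R : rcfType.
Implicit Types (a b q p : {poly R}).

(* [a + b y] in [R[x,y]/(y^2 + q)] has norm [a^2 + q b^2] down to [R[x]]. *)
Definition cnorm q a b := a ^+ 2 + b ^+ 2 * q.

(* [delta (a + b y) <= e]; multiplying by ['X^2] avoids subtracting 2 from [e]. *)
Definition dle e a b := (size a <= e.+1)%N && (size ('X^2 * b)%R <= e.+1)%N.

(** As [q] is monic of even degree, nonzero [a ^+ 2] and [b ^+ 2 * q] have positive leading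
    coefficients and cannot cancel: the norm has degree twice the pole order [e] of [a + b y]. *)
Lemma size_cnorm q a b : q \is monic -> size q = 5%N -> (a != 0) || (b != 0) ->
  exists2 e, dle e a b & size (cnorm q a b) = e.*2.+1.
Proof.
move=> qm q5; have q0 := monic_neq0 qm.
have [->|a0] /= := eqVneq a 0.
  move=> b0; exists (size b).+1; rewrite /dle ?size_poly0 /= ?size_XnM //.
  rewrite /cnorm expr0n add0r size_Mmonic ?expf_neq0 // q5 expr2 size_mul //.
  by move: b0; rewrite -size_poly_gt0; slia.
have sa : size (a ^+ 2) = (size a).*2.-1 by rewrite expr2 size_mul // addnn.
have a1 : (0 < size a)%N by rewrite size_poly_gt0.
move=> _; have [->|b0] := eqVneq b 0.
  exists (size a).-1; rewrite /dle ?mulr0 ?size_poly0 /= ?prednK ?leqnn //.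
  by rewrite /cnorm expr0n mul0r addr0 sa; slia.
have sb : size (b ^+ 2 * q) = ((size b).*2.+3)%N.
  rewrite size_Mmonic ?expf_neq0 // q5 expr2 size_mul //.
  by have := b0; rewrite -size_poly_gt0; slia.
rewrite /cnorm /dle !size_XnM //.
have [H|H|H] := ltngtP (size (a ^+ 2)) (size (b ^+ 2 * q)).
- exists (size b).+1; first by move: H; rewrite sa sb; slia.
  by rewrite addrC size_polyDl // sb; slia.
- exists (size a).-1; first by move: H; rewrite sa sb; slia.
  by rewrite size_polyDl // sa; slia.
- exists (size b).+1; first by move: H; rewrite sa sb; slia.
  apply/eqP; rewrite eqn_leq; apply/andP; split.
    by rewrite (leq_trans (size_polyD _ _)) // H maxnn sb; slia.
  have -> : (size b).+1.*2.+1 = size (b ^+ 2 * q) by rewrite sb; slia.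
  rewrite sb ltnNge; apply/negP => /leq_sizeP /(_ _ (leqnn _)) /eqP; apply/negP.
  have sa2 : size (a ^+ 2) = ((size b).*2.+3)%N by rewrite H sb.
  have -> : (a ^+ 2 + b ^+ 2 * q)`_((size b).*2.+2) =
            lead_coef (a ^+ 2) + lead_coef (b ^+ 2 * q).
    by rewrite coefD !lead_coefE sa2 sb.
  rewrite lead_coef_Mmonic // !lead_coef_exp.
  by rewrite gt_eqF // ltr_wpDl ?sqr_ge0 // exprn_even_gt0 // lead_coef_eq0.
Qed.

End CoordinateRing.

(* [pts] lists pairs [(r, t)], each asking [f + g y] to vanish at [x = r, y = t];
   [e] asks for a drop of the pole order at one of the two points at infinity. *)
Lemma small_element_exists (F : fieldType) (A B U : {poly F}) (pts : seq (F * F))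
    (w : F) (n : nat) (e : bool) :
  U != 0 -> ((size U).-1 + size pts + e < n.+2 + n)%N ->
  exists f g : {poly F},
    [/\ (f != 0) || (g != 0), (size f <= n.+2)%N /\ (size g <= n)%N,
        U %| f * B - g * A, forall pt, pt \in pts -> f.[pt.1] + pt.2 * g.[pt.1] = 0 &
        e -> f`_n.+1 + w * ('X^2 * g)`_n.+1 = 0].
Proof.
move=> U0 dimlt.
(* The unknown vector holds the [n.+2] coefficients of [f] and the [n] of [g]. The conditions are
   the remainder modulo [U], one value per listed point, and one coefficient if [e] holds, [e]
   serving as the dimension 0 or 1. *)
pose f (v : 'rV[F]_(n.+2 + n)) := rVpoly (lsubmx v).
pose g (v : 'rV[F]_(n.+2 + n)) := rVpoly (rsubmx v).
have fP c v v' : f (c *: v + v') = c *: f v + f v' by rewrite /f !linearP.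
have gP c v v' : g (c *: v + v') = c *: g v + g v' by rewrite /g !linearP.
pose phi1 v : 'rV[F]_((size U).-1) := poly_rV ((f v * B - g v * A) %% U).
pose phi2 v : 'rV[F]_(size pts) :=
  \row_j ((f v).[(nth 0 pts j).1] + (nth 0 pts j).2 * (g v).[(nth 0 pts j).1]).
pose phi3 v : 'rV[F]_e := const_mx ((f v)`_n.+1 + w * ('X^2 * g v)`_n.+1).
pose phi v := row_mx (row_mx (phi1 v) (phi2 v)) (phi3 v).
have phiL : linear phi.
  move=> c v v'; rewrite /phi !scale_row_mx !add_row_mx; congr row_mx; last first.
    apply/rowP => j; rewrite !mxE fP gP mulrDr -scalerAr !coefD !coefZ; ring.
  congr row_mx; last first.
    by apply/rowP => j; rewrite !mxE fP gP !hornerD !hornerZ; ring.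
  rewrite /phi1 -linearP -modpZl -modpD; congr (poly_rV (_ %% _)).
  by rewrite fP gP -!mul_polyC; ring.
have [v v0 phiv] := linear_kernel phiL dimlt.
move: phiv; rewrite /phi -[0]row_mx0 => /eq_row_mx [].
rewrite -[0]row_mx0 => /eq_row_mx [/(congr1 rVpoly) p1 p2] p3.
exists (f v), (g v); split.
- apply: contraNT v0; rewrite negb_or !negbK => /andP [/eqP fv /eqP gv].
  rewrite -[v]hsubmxK -(rVpolyK (lsubmx v)) -(rVpolyK (rsubmx v)).
  by rewrite -/(f v) -/(g v) fv gv !linear0 row_mx0.
- by split; apply: size_poly.
- move: p1; rewrite linear0 /phi1 poly_rV_K /dvdp => [->|] //.
  by rewrite -ltnS prednK ?size_poly_gt0 // ltn_modpN0.
- move=> pt /(nthP 0) [j jlt <-].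
  by have := congr1 (fun M : 'rV_ _ => M 0 (Ordinal jlt)) p2; rewrite !mxE.
- move: p3; rewrite /phi3; case: (e) => // p3 _.
  by have := congr1 (fun M : 'rV_ _ => M 0 0) p3; rewrite !mxE.
Qed.

(** * Multiplying a psd element into an absolute square *)

Section PsdElements.
Variables (R : rcfType) (q : {poly R}).
Hypothesis qS : simple_real_roots q.
Implicit Types (a b c p u v : {poly R}) (x y r : R).

(* Equivalent to [a + b y >= 0] at the points [(x, y)] and [(x, - y)] of the curve. *)
Definition psd_pair a b := forall x, q.[x] <= 0 -> 0 <= a.[x] /\ 0 <= (cnorm q a b).[x].

Definition coprimeC a b := forall z, ~~ (root (toC a) z && root (toC b) z).

Lemma coprime_cnorm a b : coprimeC a b -> coprimep (cnorm q a b) b.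
Proof.
move=> ab; rewrite -(coprimep_map (real_complex R)).
apply: Pdiv.ClosedField.root_coprimep => z.
rewrite -/(toC _) -/(toC b) /cnorm toCD toCM !toCX !rootE !hornerE => zN.
apply: contraNneq (ab z) => zb; move: zN; rewrite !rootE zb expr0n mul0r addr0.
by rewrite expf_eq0 /= eqxx andbT.
Qed.

Lemma coprimeC_real a b r : coprimeC a b -> a.[r] = 0 -> b.[r] != 0.
Proof.
move=> ab ar; apply: contraNneq (ab (r%:C)%C) => br.
by rewrite !rootE !toC_horner ar br eqxx.
Qed.

(** Psd-ness covers the region [q <= 0]; where [q > 0] both terms of the norm are nonnegative. The
    square of [s] is then cancelled. *)
Lemma cnorm_nonneg a b s : s != 0 -> psd_pair (s * a) (s * b) ->
  forall x, 0 <= (cnorm q a b).[x].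
Proof.
move=> s0 H; apply: (nonneg_cancel s0) => x.
have -> : s ^+ 2 * cnorm q a b = cnorm q (s * a) (s * b) by rewrite /cnorm; ring.
have [/H[]//|qx] := lerP q.[x] 0.
rewrite /cnorm !hornerE.
by rewrite addr_ge0 ?sqr_ge0 // mulr_ge0 ?sqr_ge0 // ltW.
Qed.

(** At a zero of the norm with [q >= 0] both terms vanish, so [a.[r] = 0], [b.[r] != 0] and [q.[r] =
    0]. The norm, being nonnegative, has derivative 0 there, which would make [r] a multiple root of
    [q]. *)
Lemma cnorm_nonroot a b r : coprimeC a b -> (forall x, 0 <= (cnorm q a b).[x]) ->
  0 <= q.[r] -> (cnorm q a b).[r] != 0.
Proof.
move=> ab Npos qr; apply/eqP => Nr.
have ar : a.[r] = 0.
  move: Nr; rewrite /cnorm !hornerE => /eqP.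
  have := sqr_ge0 a.[r]; have : 0 <= b.[r] ^+ 2 * q.[r].
    by rewrite mulr_ge0 ?sqr_ge0.
  move=> H1 H2 /eqP H3; have /eqP : a.[r] ^+ 2 = 0 by lra.
  by rewrite sqrf_eq0 => /eqP.
have br := coprimeC_real ab ar.
have rq : root q r.
  move: Nr; rewrite /cnorm !hornerE ar expr0n add0r => /eqP.
  by rewrite mulf_eq0 sqrf_eq0 (negbTE br).
have /factor_theorem [m EN] : root (cnorm q a b) r by apply/eqP.
have /eqP mr : root m r.
  apply: (@root_of_sign_change _ (-1)); first by rewrite !hornerE; lra.
  by move=> t _; rewrite mulrC -EN.
have : (cnorm q a b)^`().[r] = 0 by rewrite EN mulrC deriv_mulXsub.
rewrite /cnorm !expr2 derivD !derivM !(hornerD, hornerM) ar (eqP rq).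
rewrite !(mul0r, mulr0, add0r, addr0) => /eqP.
by rewrite !mulf_eq0 (negbTE br) /=; apply/negP/qS.
Qed.

End PsdElements.

(** * Absolute squares of elements with complex coefficients *)

Section AbsSquare.
Variables (R : rcfType) (q : {poly R}).
Hypotheses (qm : q \is monic) (q5 : size q = 5%N).
Hypothesis q_neg : exists x, q.[x] < 0.
Implicit Types (a b c f g h u v : {poly R}) (x y r : R).

(* [|(f1 + i f2) + (h1 + i h2) y|^2 = absR + absI y] *)
Definition absR f1 f2 h1 h2 := f1 ^+ 2 + f2 ^+ 2 - q * (h1 ^+ 2 + h2 ^+ 2).
Definition absI f1 f2 h1 h2 : {poly R} := 2%:R * (f1 * h1 + f2 * h2).

Lemma absR_ge0 f1 f2 h1 h2 x : q.[x] <= 0 -> 0 <= (absR f1 f2 h1 h2).[x].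
Proof.
rewrite /absR !(hornerD, hornerN, hornerM, horner_exp) => qx.
have := sqr_ge0 f1.[x]; have := sqr_ge0 f2.[x].
have := sqr_ge0 h1.[x]; have := sqr_ge0 h2.[x]; nra.
Qed.

Lemma definite_form_eq0 (x1 x2 y1 y2 t : R) : t < 0 ->
  x1 ^+ 2 + x2 ^+ 2 - t * (y1 ^+ 2 + y2 ^+ 2) = 0 ->
  [/\ x1 = 0, x2 = 0, y1 = 0 & y2 = 0].
Proof.
move=> t0 E; have := sqr_ge0 x1; have := sqr_ge0 x2.
have := sqr_ge0 y1; have := sqr_ge0 y2 => s1 s2 s3 s4.
have e : y1 ^+ 2 + y2 ^+ 2 = 0.
  by apply/eqP; rewrite eq_le addr_ge0 // andbT leNgt; apply/negP => ?; nra.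
rewrite e in E.
by split; apply/eqP; rewrite -sqrf_eq0; apply/eqP; lra.
Qed.

(** Where [q < 0], [absR] is a positive definite form in the four values, so all four vanish there;
    that region contains a nonroot of any nonzero polynomial. *)
Lemma abs_eq0 f1 f2 h1 h2 : simple_real_roots q -> absR f1 f2 h1 h2 = 0 ->
  [/\ f1 = 0, f2 = 0, h1 = 0 & h2 = 0].
Proof.
move=> qS H; have [x0 qx0] := q_neg.
have K x : q.[x] < 0 -> [/\ f1.[x] = 0, f2.[x] = 0, h1.[x] = 0 & h2.[x] = 0].
  move=> qx; have := congr1 (fun p => p.[x]) H.
  rewrite /absR !(hornerD, hornerN, hornerM, horner_exp) horner0.
  exact: definite_form_eq0.
have Z s : (forall x, q.[x] < 0 -> s.[x] = 0) -> s = 0.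
  move=> Hs; apply/eqP; apply: contraT => s0.
  have [y [_ qy]] := nonpos_region_dense qS s0 (ltW qx0) qx0.
  by rewrite Hs ?eqxx.
by split; apply: Z => x /K [].
Qed.

(** With [U = u + i v] the norm is [|U|^2], and the second equation makes [F = f + h y] vanish at
    the zeros of [U], where [y = - a / b]. The conclusion lists the components of [|F|^2 (a - b y)],
    so it says that [a + b y] divides [|F|^2]. Divisibility is checked after multiplying by [b],
    which is coprime to the norm. *)
Lemma cnorm_dvd_of_half a b u v f1 f2 h1 h2 g1 g2 :
  cnorm q a b = u ^+ 2 + v ^+ 2 -> coprimep (cnorm q a b) b ->
  cpoly f1 f2 * toC b - cpoly h1 h2 * toC a = cpoly g1 g2 * cpoly u v ->
  let P := absR f1 f2 h1 h2 in let Q := absI f1 f2 h1 h2 in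
  (cnorm q a b %| P * a + Q * b * q) && (cnorm q a b %| Q * a - P * b).
Proof.
move=> EN cop E; cbv zeta; set P := absR _ _ _ _; set Q := absI _ _ _ _.
have [E1 E2] : f1 * b = h1 * a + (g1 * u - g2 * v) /\
               f2 * b = h2 * a + (g1 * v + g2 * u).
  have : cpoly (f1 * b) (f2 * b) =
         cpoly (h1 * a + (g1 * u - g2 * v)) (h2 * a + (g1 * v + g2 * u)).
    move/eqP: E; rewrite subr_eq => /eqP E.
    have -> : cpoly (f1 * b) (f2 * b) = cpoly f1 f2 * toC b.
      by rewrite /cpoly !toCE; ring.
    rewrite E /cpoly !toCE; have := iP2 R; set i := iP R => i2.
    have -> : (toC g1 + i * toC g2) * (toC u + i * toC v) =
      toC g1 * toC u + i ^+ 2 * (toC g2 * toC v)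
      + i * (toC g1 * toC v + toC g2 * toC u) by ring.
    by rewrite i2; ring.
  exact: cpoly_inj.
have bY : b * (Q * a - P * b) =
          cnorm q a b * (h1 ^+ 2 + h2 ^+ 2 - (g1 ^+ 2 + g2 ^+ 2)).
  have -> : b * (Q * a - P * b) =
    2%:R * ((f1 * b) * h1 + (f2 * b) * h2) * a - (f1 * b) ^+ 2 - (f2 * b) ^+ 2
    + q * b ^+ 2 * (h1 ^+ 2 + h2 ^+ 2) by rewrite /P /Q /absR /absI; ring.
  rewrite E1 E2 mulrBr {2}EN /cnorm; ring.
have Y : cnorm q a b %| Q * a - P * b.
  by rewrite -(Gauss_dvdpr _ cop) bY dvdp_mulr.
rewrite Y andbT -(Gauss_dvdpr _ cop).
have -> : b * (P * a + Q * b * q) = Q * cnorm q a b - a * (Q * a - P * b).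
  by rewrite /cnorm; ring.
by rewrite dvdp_sub ?dvdp_mull.
Qed.

Lemma coef_XnM_add k j (p : {poly R}) : ('X^k * p)`_(k + j) = p`_j.
Proof. by rewrite coefXnM ltnNge leq_addr addKn. Qed.

(** At infinity [y] behaves like [i x^2] or [- i x^2]. The condition under [e] kills the top
    coefficient of [f + i x^2 h], so [F] loses a pole order at one point and its conjugate at the
    other; hence [|F|^2] loses one at both. *)
Lemma abs_size f1 f2 h1 h2 n (e : bool) :
  (size f1 <= n.+2)%N -> (size f2 <= n.+2)%N ->
  (size h1 <= n)%N -> (size h2 <= n)%N ->
  (e -> f1`_n.+1 = ('X^2 * h2)`_n.+1 /\ f2`_n.+1 = - ('X^2 * h1)`_n.+1) ->
  (size (absR f1 f2 h1 h2) <= n.*2.+3 - e)%N /\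
  (size ('X^2 * absI f1 f2 h1 h2)%R <= n.*2.+3 - e)%N.
Proof.
have S h : (size h <= n)%N -> (size ('X^2 * h)%R <= n.+2)%N.
  by have [->|h0] := eqVneq h 0; [rewrite mulr0 size_poly0|rewrite size_XnM].
move=> sf1 sf2 /S sh1 /S sh2 He.
have B2 (f g : {poly R}) : (size f <= n.+2)%N -> (size g <= n.+2)%N ->
    (size (f * g)%R <= n.*2.+3)%N.
  by move=> H1 H2; apply: leq_trans (size_mul_bound H1 H2) _; slia.
have T2 (f g : {poly R}) : (size f <= n.+2)%N -> (size g <= n.+2)%N ->
    (f * g)`_(n.*2.+2) = f`_n.+1 * g`_n.+1.
  by move=> H1 H2; rewrite -coef_mul_top //; congr (_`__); lia.
have P4 : 'X^4 * absR f1 f2 h1 h2 =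
  'X^4 * (f1 * f1 + f2 * f2) - q * ('X^2 * h1 * ('X^2 * h1) + 'X^2 * h2 * ('X^2 * h2)).
  by rewrite /absR; ring.
have Q2 : 'X^2 * absI f1 f2 h1 h2 =
  2%:R *: (f1 * ('X^2 * h1) + f2 * ('X^2 * h2)).
  by rewrite /absI scaler_nat; ring.
set H := 'X^2 * h1 * ('X^2 * h1) + 'X^2 * h2 * ('X^2 * h2) in P4.
have sH : (size H <= n.*2.+3)%N by rewrite size_add_bound ?B2.
have sqH : (size (q * H)%R <= (4 + n.*2.+2).+1)%N.
  by apply: size_mul_bound => //; rewrite q5.
have sff : (size (f1 * f1 + f2 * f2)%R <= n.*2.+3)%N by rewrite size_add_bound ?B2.
have sX4 : (size ('X^4 * (f1 * f1 + f2 * f2))%R <= (4 + n.*2.+2).+1)%N.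
  by apply: size_mul_bound => //; rewrite size_polyXn.
have sP4 : (size ('X^4 * absR f1 f2 h1 h2)%R <= (4 + n.*2.+2).+1)%N.
  by rewrite P4 size_add_bound ?size_polyN.
have down (p : {poly R}) k m : (size ('X^k * p)%R <= k + m)%N -> (size p <= m)%N.
  by have [->|p0] := eqVneq p 0; rewrite ?size_poly0 // size_XnM // leq_add2l.
have q4 : q`_4 = 1 by move/monicP: qm; rewrite lead_coefE q5.
split.
  apply: (down _ 4); case: e He => [[//|e1 e2]|_]; last by rewrite subn0; slia.
  rewrite subn1 /=; apply: size_leq_top; first exact: sP4.
  rewrite P4 coefB coef_XnM_add coef_mul_top ?q5 // q4 mul1r.
  by rewrite /H !coefD !T2 // e1 e2; ring.
rewrite Q2; apply: leq_trans (size_scale_leq _ _) _.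
have sQ : (size (f1 * ('X^2 * h1) + f2 * ('X^2 * h2))%R <= n.*2.+3)%N.
  by rewrite size_add_bound ?B2.
case: e He => [[//|e1 e2]|_]; last by rewrite subn0.
rewrite subn1 /=; apply: size_leq_top => //.
by rewrite coefD !T2 // e1 e2; ring.
Qed.

End AbsSquare.

(** With [n = d / 2] there are [2 n + 2] unknowns against [d] vanishing conditions; for even [d]
    this leaves room for the condition at infinity. *)
Lemma half_dim d : (d + ~~ odd d < d./2.+2 + d./2)%N.
Proof. by have := odd_double_half d; case: (odd d) => /=; lia. Qed.

(** In both parities [|F|^2] gets pole order at most [d + 1], one more than the psd element. *)
Lemma half_deg d : (d./2.*2.+3 - ~~ odd d <= d.+2)%N.
Proof. by have := odd_double_half d; case: (odd d) => /=; lia. Qed.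

(** * Half of the zeros of a psd element *)

Section HalfDivisor.
Variables (R : rcfType) (q : {poly R}).
Hypotheses (qm : q \is monic) (q5 : size q = 5%N) (qS : simple_real_roots q).
Hypothesis q_neg : exists x, q.[x] < 0.
Implicit Types (a b c f g h u v : {poly R}) (x y r : R).

Definition prodX (rs : seq R) : {poly R} := \prod_(r <- rs) ('X - r%:P).

Lemma prodX_neq0 rs : prodX rs != 0.
Proof. exact/monic_neq0/monic_prod_XsubC. Qed.

Lemma prodX_coprime rs p : {in rs, forall r, p.[r] != 0} -> coprimep (prodX rs) p.
Proof.
move=> H; rewrite coprimep_sym /prodX big_seq.
apply: (big_ind (coprimep p)); first exact: coprimep1.
  by move=> s t ps pt; rewrite coprimepMr ps pt.
by move=> r rin; rewrite coprimep_XsubC rootE H.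
Qed.

(** If [a] were 0 the norm would be [b ^+ 2 * q], negative somewhere. So [a ^+ 2] can be cancelled
    from [a * (a * c)], a product of two nonnegative factors on the region. *)
Lemma psd_nonneg_quotient a b c : (a != 0) || (b != 0) -> psd_pair q a b ->
  (forall x, q.[x] <= 0 -> 0 <= (a * c).[x]) ->
  forall x, q.[x] <= 0 -> 0 <= c.[x].
Proof.
move=> ab0 ab_psd ac; have [x0 qx0] := q_neg.
have a0 : a != 0.
  apply/negP => /eqP a0; move: ab0 ab_psd; rewrite a0 eqxx /= => b0.
  have [y [_ qy bey]] := nonpos_region_dense qS b0 (ltW qx0) qx0.
  move=> /(_ y (ltW qy)) [_]; rewrite /cnorm expr0n add0r hornerM horner_exp.
  have : 0 < b.[y] ^+ 2 by rewrite exprn_even_gt0.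
  by nra.
apply: (nonneg_on_region_cancel qS a0) => x qx.
rewrite expr2 -mulrA hornerM mulr_ge0 ?ac //.
by have [] := ab_psd x qx.
Qed.

(** Over a root [r] of [prodX rs] lies a conjugate pair of points, or a branch point when [q.[r] =
    0]. The zeros of the coprime part are split by its norm [|U|^2] into those of [U] and their
    conjugates. If [F] vanishes on one half, the whole element divides [|F|^2], with a quotient of
    pole order at most 1. *)
Lemma psd_times_linear_is_abs a b rs e :
  coprimeC a b -> uniq rs -> {in rs, forall r, 0 <= q.[r]} ->
  psd_pair q (prodX rs * a) (prodX rs * b) ->
  dle e a b -> size (cnorm q a b) = e.*2.+1 ->
  let n := (e + size rs)./2 in
  exists f1 f2 h1 h2 c,
  [/\ [/\ (size f1 <= n.+2)%N, (size f2 <= n.+2)%N,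
          (size h1 <= n)%N & (size h2 <= n)%N],
      prodX rs * a * c = absR q f1 f2 h1 h2,
      prodX rs * b * c = absI f1 f2 h1 h2,
      c != 0 /\ (size c <= 2)%N &
      forall x, q.[x] <= 0 -> 0 <= c.[x]].
Proof.
move=> ab rsU rs_q ab_psd /andP [sa sb] sN n.
set g := prodX rs in ab_psd *; set d := (e + size rs)%N in n *.
have g0 : g != 0 := prodX_neq0 rs.
have sg : size g = (size rs).+1 by rewrite /g /prodX size_prod_XsubC.
have Npos := cnorm_nonneg g0 ab_psd.
have [u [v EN]] := nonneg_sum_two_squares Npos.
have N0 : cnorm q a b != 0 by rewrite -size_poly_gt0 sN.
have EU := cpoly_norm u v; set U := cpoly u v in EU.
have U0 : U != 0.
  apply: contraNneq N0 => U0; have [u0 v0] := cpoly_eq0 U0.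
  by rewrite EN u0 v0 expr0n addr0.
have sU : size U = e.+1.
  have := congr1 (fun p : {poly R[i]} => size p) EU.
  rewrite size_toC -EN sN size_mul ?[size (cpoly u (- v))]size_cpolyN //.
    by rewrite -/U; clear; slia.
  by rewrite -size_poly_gt0 size_cpolyN size_poly_gt0.
(* One of the points with [y = i sqrt q(r)] and [y = - i sqrt q(r)] over each [r]; the conjugate of
   [F] vanishes at the other. *)
pose pts := [seq ((r%:C)%C, Complex 0 (Num.sqrt q.[r])) | r <- rs].
have dimlt : ((size U).-1 + size pts + ~~ odd d < n.+2 + n)%N.
  by rewrite sU size_map -/d /=; apply: half_dim.
have [F [H [FH0 [sF sH] UFH FHpts FHinf]]] :=
  small_element_exists (toC a) (toC b) ('i%C) U0 dimlt.
have [f1 [f2 EF]] := cpoly_surj F; have [h1 [h2 EH]] := cpoly_surj H.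
have [G EG] := dvdpP _ _ UFH; have [g1 [g2 EGc]] := cpoly_surj G.
move: sF sH; rewrite EF EH !size_cpoly_le => /andP [sf1 sf2] /andP [sh1 sh2].
rewrite EF EH EGc in EG.
have cop := coprime_cnorm q ab.
have /andP [NX NY] := cnorm_dvd_of_half EN cop EG.
have [P defP] : exists P, P = absR q f1 f2 h1 h2 by eexists.
have [Q defQ] : exists Q, Q = absI f1 f2 h1 h2 by eexists.
rewrite -defP -defQ in NX NY *.
have [sP sQ] : (size P <= n.*2.+3 - ~~ odd d)%N /\
               (size ('X^2 * Q)%R <= n.*2.+3 - ~~ odd d)%N.
  rewrite defP defQ; apply: abs_size => // /FHinf; rewrite EF EH => E.
  have : (cpoly f1 f2)`_n.+1 + 'i%C * ('X^2 * cpoly h1 h2)`_n.+1 =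
         Complex (f1`_n.+1 - ('X^2 * h2)`_n.+1) (f2`_n.+1 + ('X^2 * h1)`_n.+1).
    have -> : 'X^2 * cpoly h1 h2 = cpoly ('X^2 * h1) ('X^2 * h2).
      by rewrite /cpoly !toCE /toC map_polyX; ring.
    rewrite !coef_cpoly; apply/eqP; rewrite eq_complex /=.
    by apply/andP; split; apply/eqP; ring.
  rewrite E => -[/esym/eqP]; rewrite subr_eq0 => /eqP -> /esym/eqP.
  by rewrite addr_eq0 => /eqP ->.
have {}sP : (size P <= d.+2)%N by exact: leq_trans sP (half_deg d).
have {}sQ : (size ('X^2 * Q)%R <= d.+2)%N by exact: leq_trans sQ (half_deg d).
have rPQ r : r \in rs -> root P r /\ root Q r.
  move=> rin; have /FHpts : ((r%:C)%C, Complex 0 (Num.sqrt q.[r])) \in pts.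
    by apply/mapP; exists r.
  rewrite EF EH /= /cpoly !hornerE !toC_horner /= => /eqP.
  rewrite eq_complex /= => /andP [/eqP e1 /eqP e2].
  have s2 : Num.sqrt q.[r] ^+ 2 = q.[r] by rewrite sqr_sqrtr ?rs_q.
  set s := Num.sqrt _ in e1 e2 s2.
  have e1' : f1.[r] = s * h2.[r] by lra.
  have e2' : f2.[r] = - (s * h1.[r]) by lra.
  rewrite !rootE defP defQ /absR /absI !(hornerD, hornerN, hornerM, horner_exp).
  rewrite e1' e2' -s2; split; apply/eqP; last by ring.
  by ring.
have copgN : coprimep g (cnorm q a b).
  by apply: prodX_coprime => r /rs_q qr; apply: cnorm_nonroot.
have gdvd s : {in rs, forall r, root s r} -> g %| s.
  by move=> Hs; apply: uniq_roots_dvdp; [apply/allP|rewrite uniq_rootsE].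
have gX : g * cnorm q a b %| P * a + Q * b * q.
  rewrite Gauss_dvdp // NX andbT; apply: gdvd => r /rPQ [/eqP Pr /eqP Qr].
  by rewrite rootE !(hornerD, hornerM) Pr Qr !mul0r addr0.
have gY : g * cnorm q a b %| Q * a - P * b.
  rewrite Gauss_dvdp // NY andbT; apply: gdvd => r /rPQ [/eqP Pr /eqP Qr].
  by rewrite rootE !(hornerD, hornerN, hornerM) Pr Qr !mul0r subr0.
have [c EX] := dvdpP _ _ gX; have [c2 EY] := dvdpP _ _ gY.
have sgN s : s != 0 -> size (s * (g * cnorm q a b)) = (size s + d + e)%N.
  move=> s0; rewrite size_mul ?mulf_neq0 // size_mul // sg sN /d.
  by move: s0; rewrite -size_poly_gt0; clear; slia.
(* The [y] component of [|F|^2 (a - b y)] has degree at most [d + e - 1], less than the degree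
   [d + e] of its divisor [g * cnorm q a b]. *)
have c20 : c2 = 0.
  apply: contraTeq isT => c20.
  have : (size ('X^2 * (Q * a - P * b))%R <= d.+1 + e.+1)%N.
    have -> : 'X^2 * (Q * a - P * b) = 'X^2 * Q * a - P * ('X^2 * b) by ring.
    rewrite addnS; apply: size_add_bound; rewrite ?size_polyN; exact: size_mul_bound.
  rewrite EY size_XnM ?mulf_neq0 // sgN //.
  by move: c20; rewrite -size_poly_gt0; clear; slia.
move: EY; rewrite c20 mul0r => EY.
(* The other component has degree at most [d + e + 1], one more than the same divisor. *)
have sc : (size c <= 2)%N.
  have [->|c0] := eqVneq c 0; first by rewrite size_poly0.
  have : (size ('X^4 * (P * a + Q * b * q))%R <= (4 + (d.+1 + e)).+1)%N.
    have -> : 'X^4 * (P * a + Q * b * q) =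
      'X^4 * (P * a) + q * ('X^2 * Q * ('X^2 * b)) by ring.
    apply: size_add_bound; apply: size_mul_bound; rewrite ?size_polyXn ?q5 //;
      exact: size_mul_bound.
  by rewrite EX size_XnM ?mulf_neq0 // sgN //; clear; slia.
(* Multiplying back by [a + b y] and cancelling the norm recovers [|F|^2]. *)
have EP : g * a * c = P.
  apply: (mulIf N0).
  have -> : P * cnorm q a b = a * (P * a + Q * b * q) - b * q * (Q * a - P * b).
    by rewrite /cnorm; ring.
  by rewrite EX EY mulr0 subr0; ring.
have EQ : g * b * c = Q.
  apply: (mulIf N0).
  have -> : Q * cnorm q a b = b * (P * a + Q * b * q) + a * (Q * a - P * b).
    by rewrite /cnorm; ring.
  by rewrite EX EY mulr0 addr0; ring.
have c0 : c != 0.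
  apply: contraTneq FH0 => c0; move: EP; rewrite c0 mulr0 defP => /esym PE.
  have [f10 f20 h10 h20] := abs_eq0 q_neg qS PE.
  by rewrite EF EH f10 f20 h10 h20 /cpoly /toC map_poly0 mulr0 addr0 eqxx.
exists f1, f2, h1, h2, c; split => //; rewrite -?defP -?defQ //.
apply: psd_nonneg_quotient ab_psd _.
  rewrite !mulf_eq0 (negbTE g0) /= -negb_and; apply: contraNN N0.
  by move=> /andP [/eqP -> /eqP ->]; rewrite /cnorm expr0n mul0r addr0.
by move=> x qx; rewrite EP defP; apply: absR_ge0.
Qed.

End HalfDivisor.

(** * The certificates for [x - r] and [r' - x] *)

Section PowerTimesQuadratic.
Variables (R : archiRcfType) (b c T : R).
Implicit Types z t : R.
Let Q z := z ^+ 2 + b * z + c.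
Hypotheses (T0 : 0 < T) (Qpos : forall z, T <= z -> 0 < Q z)
  (Qneg : forall z, z <= 0 -> 0 <= Q z).

(** [T + T + b] is the derivative of [Q] at [T]: if it is nonnegative the minimum beyond [T] is at
    [T], otherwise the vertex [- b / 2] serves. *)
Lemma quadratic_lower_bound : exists2 m : R, 0 < m & forall z, T <= z -> m <= Q z.
Proof.
have [bT|bT] := lerP 0 (T + T + b).
  by exists (Q T); [apply: Qpos|move=> z Tz; rewrite /Q; nra].
exists (Q (- b / 2)); first by apply: Qpos; lra.
by move=> z _; have := sqr_ge0 (z + b / 2); rewrite /Q; lra.
Qed.

(** [1 - t ^+ j.+1] is [1 - t] times a sum of [j + 1] powers of [t], each at least [t ^+ j]. *)
Lemma sub1_exp_ge j t : 0 <= t <= 1 -> j.+1%:R * (1 - t) * t ^+ j <= 1 - t ^+ j.+1.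
Proof.
move=> /andP [t0 t1]; elim: j => [|j IHj]; first by rewrite expr0 expr1; lra.
have tj : 0 <= t ^+ j by apply: exprn_ge0.
have := mulr_ge0 (mulr_ge0 (ler0n R j.+1) tj) (sqr_ge0 (1 - t)).
move: IHj; rewrite !exprS -!natr1; set s := t ^+ j; set k := j%:R => H1 H2.
by nra.
Qed.

Lemma Bernoulli_ge j t : 0 <= t -> 1 + j%:R * t <= (1 + t) ^+ j.
Proof.
move=> t0; elim: j => [|j IHj]; first by rewrite expr0; lra.
have k0 := ler0n R j.
rewrite exprS -natr1; move: IHj k0; set s := (1 + t) ^+ j; set k := j%:R.
by nra.
Qed.

(** The ratio of [z ^+ j * Q z] to its value at [T] is at most 1 left of [T] and at least 1 right of
    it. For [z <= 0] the odd power makes it nonpositive; elsewhere [t = z / T] is compared with 1,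
    each side of [T] using one of the two lower bounds on [j]. *)
Lemma power_times_quadratic_crossing (m : R) j z : odd j ->
  (forall z, T <= z -> m <= Q z) -> 0 < m ->
  0 <= T * (T + T + b) + j%:R * m -> c <= j.+1%:R * Q T ->
  0 <= (T - z) * (1 - (T ^+ j * Q T)^-1 * (z ^+ j * Q z)).
Proof.
move=> jodd Qm m0 jm jc; have Tgt0 := T0; have QT0 : 0 < Q T by apply: Qpos.
have TQ : 0 < T ^+ j * Q T by rewrite mulr_gt0 // exprn_gt0.
have [z0|z0] := lerP z 0.
  apply: mulr_ge0; first by lra.
  rewrite subr_ge0; apply: le_trans ler01; rewrite -oppr_ge0 -mulrN.
  apply: mulr_ge0; first by rewrite invr_ge0 ltW.
  by rewrite -mulNr mulr_ge0 ?Qneg // oppr_ge0 exprn_odd_le0.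
set t := z / T; have t0 : 0 < t by rewrite divr_gt0.
have Ez : z = t * T by rewrite /t divfK // gt_eqF.
have tj0 : 0 < t ^+ j by rewrite exprn_gt0.
have -> : 1 - (T ^+ j * Q T)^-1 * (z ^+ j * Q z) = (Q T - t ^+ j * Q z) / Q T.
  rewrite {1}Ez exprMn; field; rewrite gt_eqF //= expf_neq0 ?gt_eqF //.
rewrite mulrA; apply: divr_ge0; last exact: ltW.
have [zT|zT] := lerP z T.
  have t1 : t <= 1 by rewrite /t ler_pdivrMr // mul1r.
  apply: mulr_ge0; first by lra.
  have := @sub1_exp_ge j t; rewrite t1 ltW // => /(_ isT) H.
  (* By convexity [Q] lies below its chord from [Q 0 = c] to [Q T]. *)
  have Qz : Q z <= (1 - t) * c + t * Q T.
    rewrite Ez /Q; have : 0 <= (t - t ^+ 2) * T ^+ 2.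
      by rewrite mulr_ge0 ?sqr_ge0 //; nra.
    by nra.
  have := ler_wpM2l (ltW tj0) Qz.
  have := ler_wpM2l (ltW tj0) (ler_wpM2l (_ : 0 <= 1 - t) jc).
  rewrite subr_ge0 => /(_ t1); have := ler_wpM2r (ltW QT0) H.
  rewrite exprSr; set s := t ^+ j; set n := j.+1%:R; set q := Q T; set y := Q z.
  by nra.
apply: mulr_le0; first by lra.
have t1 : 1 <= t by rewrite /t ler_pdivlMr // mul1r ltW.
have E1t : 1 + (t - 1) = t by ring.
have := @Bernoulli_ge j (t - 1); rewrite subr_ge0 E1t => /(_ t1) H.
have mz := Qm z (ltW zT).
have Qz : Q z = Q T + (t - 1) * (T * (T + T + b)) + (t - 1) ^+ 2 * T ^+ 2.
  by rewrite Ez /Q; ring.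
have H1 := ler_wpM2r (ltW (lt_le_trans m0 mz)) H.
rewrite subr_le0; apply: le_trans H1.
have H2 : 0 <= (t - 1) * (T * (T + T + b) + (t - 1) * T ^+ 2 + j%:R * Q z).
  apply: mulr_ge0; first by lra.
  have := mulr_ge0 (_ : 0 <= t - 1) (sqr_ge0 T); rewrite subr_ge0 => /(_ t1).
  have := ler_wpM2l (ler0n R j) mz; lra.
by rewrite mulrDl mul1r {1}Qz; nra.
Qed.

(* Used with [z = r' - x] and [z = x - r], where [T = r' - r] and
   [q = z * (z - T) * Q z]: then [T - z + q * (A * z ^+ k.*2)] is nonnegative. *)
Lemma odd_power_crossing : exists (A : R) k, 0 <= A /\
  forall z, 0 <= (T - z) * (1 - A * (z ^+ k.*2 * (z * Q z))).
Proof.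
have [m m0 Qm] := quadratic_lower_bound.
set D := T * (T + T + b); have QT0 : 0 < Q T by apply: Qpos.
(* [B] collects the thresholds for [j] on the two sides of [T]; [j] is an odd number above both. *)
pose B : R := Num.max (- D / m) (c / Q T).
pose k := Num.Def.archi_bound `|B|; pose j := k.*2.+1.
have jB : B <= j%:R.
  apply: le_trans (ler_norm _) _; have /ltW := archi_boundP (normr_ge0 B).
  by move/le_trans; apply; rewrite ler_nat /j -addnn -addnS leq_addr.
have jm : 0 <= D + j%:R * m.
  have : - D / m <= j%:R by apply: le_trans jB; rewrite le_max lexx.
  by rewrite ler_pdivrMr //; lra.
have jc : c <= j.+1%:R * Q T.
  have : c / Q T <= j%:R by apply: le_trans jB; rewrite le_max lexx orbT.
  by rewrite ler_pdivrMr // -natr1; lra.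
exists (T ^+ j * Q T)^-1, k; split.
  by rewrite invr_ge0 mulr_ge0 ?exprn_ge0 ?ltW.
move=> z; rewrite [z ^+ _ * (z * _)]mulrA -exprSr.
apply: power_times_quadratic_crossing Qm m0 jm jc.
by rewrite /= odd_double.
Qed.

End PowerTimesQuadratic.

(** * The extreme real roots of the quartic *)

Section ExtremalRoots.
Variable R : rcfType.
Implicit Types (p q : {poly R}) (x r : R).

Lemma seq_min (s : seq R) x : x \in s ->
  exists2 m, m \in s & forall y, y \in s -> m <= y.
Proof.
elim: s x => [//|z s IHs] x _; have [s0|] := eqVneq s [::].
  by exists z; rewrite s0 ?mem_head // => y; rewrite inE => /eqP ->.
case: s IHs => // w s IHs _; have [m ms mle] := IHs w (mem_head _ _).
have [zm|mz] := lerP z m.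
  exists z; first exact: mem_head.
  move=> y; rewrite inE => /orP [/eqP -> //|/mle]; exact: le_trans.
exists m; first by rewrite inE ms orbT.
by move=> y; rewrite inE => /orP [/eqP ->|/mle //]; exact: ltW.
Qed.

Lemma root_right p x : p \is monic -> p.[x] < 0 -> exists2 r, root p r & x < r.
Proof.
move=> pm px; have : 0 < lead_coef p by rewrite (monicP pm).
move=> /poly_pinfty_gt_lc [n Hn]; rewrite (monicP pm) in Hn.
pose B := Num.max n x; have xB : x <= B by rewrite /B le_max lexx orbT.
have pB : 1 <= p.[B] by apply: Hn; rewrite /B le_max lexx.
have : p.[x] <= 0 <= p.[B] by rewrite ltW //= (le_trans ler01).
move=> /(poly_ivt xB) [r /andP [xr _] rr].
exists r => //; rewrite lt_neqAle xr andbT.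
by apply: contraTneq px => ->; rewrite (rootP rr) ltxx.
Qed.

Lemma min_root p x : p != 0 -> root p x ->
  exists2 r, root p r & forall y, root p y -> r <= y.
Proof.
move=> p0 px; have E y : root p y = (y \in rootsR p).
  by rewrite -roots_on_rootsR // in_itv.
have xin : x \in rootsR p by rewrite -E.
by have [r rin rle] := seq_min xin; exists r => [|y]; rewrite E //; apply: rle.
Qed.

Lemma root_compN p x : root (p \Po - 'X) x = root p (- x).
Proof. by rewrite !rootE horner_comp hornerN hornerX. Qed.

(** Four times the value at [x] is [(2 x + s)^2 - d] with [d] the discriminant. A value [<= 0] makes
    [d >= 0] and puts the smaller root [(- s - e) / 2] at or left of [x], against the hypothesis. *)
Lemma quadratic_pos_left (s t x0 : R) :
  (forall x, x <= x0 -> x ^+ 2 + s * x + t != 0) ->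
  forall x, x <= x0 -> 0 < x ^+ 2 + s * x + t.
Proof.
move=> H x xx0; rewrite ltNge; apply/negP => le0.
pose d := s ^+ 2 - 4%:R * t.
have dge : (x + x + s) ^+ 2 <= d by rewrite /d; nra.
have d0 : 0 <= d by apply: le_trans dge; exact: sqr_ge0.
pose e := Num.sqrt d; have e2 : e ^+ 2 = d by rewrite sqr_sqrtr.
have ege : - (x + x + s) <= e.
  rewrite (le_trans (ler_norm _)) // normrN -sqrtr_sqr ler_sqrt //.
have : (- s - e) / 2%:R <= x0 by apply: le_trans xx0; lra.
move=> /H /eqP; apply; move: e2; rewrite /d.
have -> : ((- s - e) / 2) ^+ 2 + s * ((- s - e) / 2) + t
          = (e ^+ 2 - (s ^+ 2 - 4 * t)) / 4 by field.
by move=> ->; rewrite subrr mul0r.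
Qed.

Lemma quadratic_pos_right (s t x0 : R) :
  (forall x, x0 <= x -> x ^+ 2 + s * x + t != 0) ->
  forall x, x0 <= x -> 0 < x ^+ 2 + s * x + t.
Proof.
move=> H x xx0; have -> : x ^+ 2 + s * x + t = (- x) ^+ 2 + (- s) * (- x) + t.
  by ring.
apply: (@quadratic_pos_left _ _ (- x0)); last by rewrite lerN2.
move=> y; rewrite lerNr => /H.
by have -> : (- y) ^+ 2 + s * - y + t = y ^+ 2 + - s * y + t by ring.
Qed.

(** [q] is negative somewhere and positive near both ends of the line, so its extreme real roots are
    distinct. Being simple and extreme, they leave a monic quadratic cofactor without zeros on the
    two outer rays. *)
Lemma extremal_roots q : q \is monic -> size q = 5%N -> simple_real_roots q ->
  (exists x, q.[x] < 0) ->
  exists r r' s t : R,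
  [/\ r < r',
      q = ('X - r%:P) * ('X - r'%:P) * ('X^2 + s *: 'X + t%:P),
      forall x, x <= r -> 0 < x ^+ 2 + s * x + t &
      forall x, r' <= x -> 0 < x ^+ 2 + s * x + t].
Proof.
move=> qm q5 qS [x0 qx0]; have q0 := monic_neq0 qm.
(* Reflection turns the left end of the line into the right one; the even degree keeps the
   polynomial monic. *)
have Nm : (q \Po - 'X) \is monic.
  rewrite monicE lead_coef_comp ?size_polyN ?size_polyX // (monicP qm) q5 mul1r.
  by rewrite lead_coefN lead_coefX -signr_odd /= expr0.
have N0 := monic_neq0 Nm.
have [y ry x0y] := root_right qm qx0.
have [z rz x0z] : exists2 z, root (q \Po - 'X) z & - x0 < z.
  by apply: root_right Nm _; rewrite horner_comp hornerN hornerX opprK.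
have [n rn nmin] := min_root N0 rz.
have [r rr rmin] : exists2 r, root q r & forall y, root q y -> r <= y.
  by apply: min_root q0 ry.
have [r' rr' r'max] : exists2 r', root q r' & forall y, root q y -> y <= r'.
  exists (- n); first by rewrite -root_compN.
  by move=> w rw; rewrite lerNr; apply: nmin; rewrite root_compN opprK.
have rx0 : r < x0.
  by apply: le_lt_trans (_ : - z < x0); [apply: rmin; rewrite -root_compN|lra].
have rlt : r < r' by apply: lt_trans rx0 (lt_le_trans x0y (r'max _ ry)).
have /factor_theorem [q1 E1] := rr.
have /factor_theorem [q2 E2] : root q1 r'.
  move: rr'; rewrite E1 rootM => /orP [//|].
  by rewrite root_XsubC (gt_eqF rlt).
have E : q = ('X - r%:P) * ('X - r'%:P) * q2 by rewrite E1 E2; ring.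
have q2m : q2 \is monic.
  by move: qm; rewrite E !monicMl ?monicXsubC // monicMl ?monicXsubC // monicMl ?monicXsubC.
have s2 : size q2 = 3%N.
  have := q5; rewrite E -mulrA !size_monicM ?monicXsubC ?mulf_neq0 ?polyXsubC_eq0 ?monic_neq0 //.
  rewrite !size_XsubC; clear; slia.
have Eq2 : q2 = 'X^2 + q2`_1 *: 'X + (q2`_0)%:P.
  apply/polyP => k; rewrite !coefD coefZ coefX coefC coefXn.
  case: k => [|[|[|k]]] /=; rewrite ?mulr0 ?mulr1 ?add0r ?addr0 //.
    by move/monicP: q2m; rewrite lead_coefE s2.
  by apply/(leq_sizeP q2 3) => //; rewrite s2.
have h2 x : q2.[x] = x ^+ 2 + q2`_1 * x + q2`_0 by rewrite {1}Eq2 !hornerE.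
have nr : ~~ root q2 r.
  have := qS r rr; rewrite E -mulrA [root _^`() _]rootE deriv_mulXsub.
  by rewrite hornerM mulf_eq0 negb_or => /andP [].
have nr' : ~~ root q2 r'.
  have := qS r' rr'; rewrite E [_ * ('X - r'%:P)]mulrC -mulrA.
  rewrite [root _^`() _]rootE deriv_mulXsub.
  by rewrite hornerM mulf_eq0 negb_or => /andP [].
exists r, r', q2`_1, q2`_0; split => //; first by rewrite -Eq2.
  apply: quadratic_pos_left => x xr; rewrite -h2.
  apply: contra nr => qx; suff <- : x = r by [].
  by apply/eqP; rewrite eq_le xr rmin // E rootM [root q2 x]qx orbT.
apply: quadratic_pos_right => x xr; rewrite -h2.
apply: contra nr' => qx; suff <- : x = r' by [].
by apply/eqP; rewrite eq_le xr r'max // E rootM [root q2 x]qx orbT.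
Qed.

End ExtremalRoots.

Lemma end_certificates (R : archiRcfType) (q : {poly R}) :
  q \is monic -> size q = 5%N -> simple_real_roots q -> (exists x, q.[x] < 0) ->
  exists (r r' : R) (w w' : {poly R}),
  [/\ r < r', q.[r] = 0 /\ q.[r'] = 0,
      forall x, 0 <= w.[x] /\ 0 <= (('X - r%:P) + q * w).[x],
      forall x, 0 <= w'.[x] /\ 0 <= ((r'%:P - 'X) + q * w').[x] &
      forall x, x <= r \/ r' <= x -> 0 <= q.[x]].
Proof.
move=> qm q5 qS q_neg.
have [r [r' [s [t [rr' E posl posr]]]]] := extremal_roots qm q5 qS q_neg.
have hq x : q.[x] = (x - r) * (x - r') * (x ^+ 2 + s * x + t).
  by rewrite E !hornerE.
have T0 : 0 < r' - r by rewrite subr_gt0.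
(* With [z = r' - x] the quadratic cofactor of [q] gets these coefficients in [z], and
   [x - r = T - z]. *)
have [||A [k [A0 HA]]] := @odd_power_crossing _ (- (r' + r' + s))
    (r' ^+ 2 + s * r' + t) (r' - r) T0.
- move=> z zT; have : r' - z <= r by lra.
  by move=> /posl; congr (0 < _); ring.
- move=> z z0; have : r' <= r' - z by lra.
  by move=> /posr /ltW; congr (0 <= _); ring.
have [||A' [k' [A'0 HA']]] := @odd_power_crossing _ (r + r + s)
    (r ^+ 2 + s * r + t) (r' - r) T0.
- move=> z zT; have : r' <= r + z by lra.
  by move=> /posr; congr (0 < _); ring.
- move=> z z0; have : r + z <= r by lra.
  by move=> /posl /ltW; congr (0 <= _); ring.
exists r, r', (A *: (r'%:P - 'X) ^+ k.*2), (A' *: ('X - r%:P) ^+ k'.*2); split => //.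
- by rewrite !hq !subrr mulr0 !mul0r.
- move=> x; split.
    by rewrite hornerZ horner_exp mulr_ge0 // -mul2n exprM exprn_ge0 ?sqr_ge0.
  have := HA (r' - x); congr (0 <= _).
  rewrite !(hornerD, hornerM, hornerN, hornerZ, horner_exp, hornerX, hornerC) hq.
  set P := (_ ^+ k.*2); ring.
- move=> x; split.
    by rewrite hornerZ horner_exp mulr_ge0 // -mul2n exprM exprn_ge0 ?sqr_ge0.
  have := HA' (x - r); congr (0 <= _).
  rewrite !(hornerD, hornerM, hornerN, hornerZ, horner_exp, hornerX, hornerC) hq.
  set P := (_ ^+ k'.*2); ring.
- move=> x [xr|xr]; rewrite hq.
    by apply: mulr_ge0; [nra|exact/ltW/posl].
  by apply: mulr_ge0; [nra|exact/ltW/posr].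
Qed.

(** * Sums of squares from a multiple that is an absolute square *)

Section Rotations.
Variable R : rcfType.
Implicit Types (p b c f h : {poly R}).

(** [p1 ^+ 2 + p2 ^+ 2] is [|p1 + i p2|^2], of twice the degree of [p1 + i p2]. *)
Lemma size_two_squares p1 p2 k : (size (p1 ^+ 2 + p2 ^+ 2)%R <= k)%N ->
  (size p1 <= k)%N /\ (size p2 <= k)%N.
Proof.
move=> H; suff : (size (cpoly p1 p2) <= k)%N by rewrite size_cpoly_le => /andP [].
have [->|U0] := eqVneq (cpoly p1 p2) 0; first by rewrite size_poly0.
move: H; rewrite -size_toC cpoly_norm size_mul //.
  by rewrite size_cpolyN; move: U0; rewrite -size_poly_gt0; clear; slia.
by rewrite -size_poly_gt0 size_cpolyN size_poly_gt0.
Qed.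

(** For complex [x = x1 + i x2] and [y = y1 + i y2], the hypotheses say that [x / y] has squared
    modulus [t] and is purely imaginary; so [x = i s y] with [s] real. *)
Lemma sqrt_of_ratio (x1 x2 y1 y2 t : R) : 0 <= t ->
  x1 ^+ 2 + x2 ^+ 2 = t * (y1 ^+ 2 + y2 ^+ 2) -> x1 * y1 + x2 * y2 = 0 ->
  exists s, [/\ s ^+ 2 = t, x1 = - (s * y2) & x2 = s * y1].
Proof.
move=> t0 E1 E2; have [n0|n0] := eqVneq (y1 ^+ 2 + y2 ^+ 2) 0.
  have s1 := sqr_ge0 x1; have s2 := sqr_ge0 x2.
  have s3 := sqr_ge0 y1; have s4 := sqr_ge0 y2.
  rewrite n0 mulr0 in E1.
  have [-> -> -> ->] : [/\ x1 = 0, x2 = 0, y1 = 0 & y2 = 0].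
    by split; apply/eqP; rewrite -sqrf_eq0; apply/eqP; lra.
  by exists (Num.sqrt t); rewrite sqr_sqrtr // mulr0 oppr0.
set n := y1 ^+ 2 + y2 ^+ 2 in E1 n0.
exists ((x2 * y1 - x1 * y2) / n); split.
- apply: (mulIf (expf_neq0 2 n0)); rewrite exprMn exprVn -mulrA mulVf ?expf_neq0 //.
  have -> : t * n ^+ 2 = (t * n) * n by ring.
  rewrite -E1 mulr1.
  have -> : (x1 ^+ 2 + x2 ^+ 2) * n =
    (x2 * y1 - x1 * y2) ^+ 2 + (x1 * y1 + x2 * y2) ^+ 2 by rewrite /n; ring.
  by rewrite E2; ring.
- apply: (mulIf n0); rewrite mulNr mulrAC divfK //.
  have : x1 * n + (x2 * y1 - x1 * y2) * y2 = (x1 * y1 + x2 * y2) * y1.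
    by rewrite /n; ring.
  by rewrite E2 mul0r => /eqP; rewrite addr_eq0 => /eqP.
- apply: (mulIf n0); rewrite mulrAC divfK //.
  have : x2 * n - (x2 * y1 - x1 * y2) * y1 = (x1 * y1 + x2 * y2) * y2.
    by rewrite /n; ring.
  by rewrite E2 mul0r => /eqP; rewrite subr_eq0 => /eqP.
Qed.

(** Multiplying [p1 + i p2] by a complex number of modulus 1 keeps the sum of squares; [w1 + i w2]
    is the quotient of the prescribed value by the current one. *)
Lemma rotate_to p1 p2 (x v1 v2 : R) :
  p1.[x] ^+ 2 + p2.[x] ^+ 2 = v1 ^+ 2 + v2 ^+ 2 ->
  exists r1 r2, [/\ r1 ^+ 2 + r2 ^+ 2 = p1 ^+ 2 + p2 ^+ 2, r1.[x] = v1 & r2.[x] = v2].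
Proof.
move=> E; have [n0|n0] := eqVneq (p1.[x] ^+ 2 + p2.[x] ^+ 2) 0.
  have s1 := sqr_ge0 p1.[x]; have s2 := sqr_ge0 p2.[x].
  have s3 := sqr_ge0 v1; have s4 := sqr_ge0 v2.
  exists p1, p2; have [-> -> -> ->] : [/\ p1.[x] = 0, p2.[x] = 0, v1 = 0 & v2 = 0].
    by split; apply/eqP; rewrite -sqrf_eq0; apply/eqP; lra.
  by [].
move: n0 E; set x1 := p1.[x]; set x2 := p2.[x]; set n := x1 ^+ 2 + x2 ^+ 2 => n0 E.
have [w1 e1] : exists w, w * n = v1 * x1 + v2 * x2.
  by exists ((v1 * x1 + v2 * x2) / n); rewrite divfK.
have [w2 e2] : exists w, w * n = v2 * x1 - v1 * x2.
  by exists ((v2 * x1 - v1 * x2) / n); rewrite divfK.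
have w12 : w1 ^+ 2 + w2 ^+ 2 = 1.
  apply: (mulIf (expf_neq0 2 n0)); rewrite mul1r mulrDl -!exprMn e1 e2.
  have -> : n ^+ 2 = n * (v1 ^+ 2 + v2 ^+ 2) by rewrite -E.
  by rewrite /n; ring.
exists (w1%:P * p1 - w2%:P * p2), (w1%:P * p2 + w2%:P * p1); split.
- have -> : (w1%:P * p1 - w2%:P * p2) ^+ 2 + (w1%:P * p2 + w2%:P * p1) ^+ 2 =
    (w1%:P ^+ 2 + w2%:P ^+ 2) * (p1 ^+ 2 + p2 ^+ 2) by ring.
  by rewrite -!rmorphXn -rmorphD /= w12 mul1r.
- rewrite !(hornerD, hornerN, hornerM, hornerC) -/x1 -/x2; apply: (mulIf n0).
  rewrite mulrBl [_ * x1 * n]mulrAC [_ * x2 * n]mulrAC e1 e2 /n; ring.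
- rewrite !(hornerD, hornerN, hornerM, hornerC) -/x1 -/x2; apply: (mulIf n0).
  rewrite mulrDl [_ * x1 * n]mulrAC [_ * x2 * n]mulrAC e1 e2 /n; ring.
Qed.

End Rotations.

Definition sos_le (R : rcfType) (q : {poly R}) (e : nat) (a b : {poly R}) :=
  exists2 l : seq ({poly R} * {poly R}), all (fun g => dle e g.1 g.2) l &
    a = \sum_(g <- l) (g.1 ^+ 2 - q * g.2 ^+ 2) /\
    b = \sum_(g <- l) 2%:R * (g.1 * g.2).

(** * Dividing an absolute square by a factor of degree at most 1 *)

Section LinearMultiple.
Variables (R : archiRcfType) (q : {poly R}).
Hypotheses (qm : q \is monic) (q5 : size q = 5%N) (qS : simple_real_roots q).
Hypothesis q_neg : exists x, q.[x] < 0.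
Implicit Types (a b c f g h p : {poly R}).

Lemma linear_factor_quotient (c g : {poly R}) (x : R) : c != 0 -> (size c <= 2)%N ->
  root c x -> root g x -> exists2 g', g = c * g' & (size g' <= size g)%N.
Proof.
move=> c0 sc /factor_theorem [c' Ec] /factor_theorem [g' Eg].
have c'0 : c' != 0 by apply: contraNneq c0 => c'0; rewrite Ec c'0 mul0r.
have sc' : (size c' <= 1)%N.
  by move: sc; rewrite Ec size_Mmonic ?monicXsubC // size_XsubC addn2.
have Ec' := size1_polyC sc'.
have d0 : c'`_0 != 0 by rewrite -polyC_eq0 -Ec'.
have Eq : g = c * ((c'`_0)^-1 *: g').
  rewrite Eg Ec {1}Ec' -mul_polyC.
  have : (c'`_0)%:P * ((c'`_0)^-1)%:P = 1 :> {poly R} by rewrite -polyCM divff.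
  set u := _%:P; set v := (_^-1)%:P => uv.
  have -> : u * ('X - x%:P) * (v * g') = u * v * (g' * ('X - x%:P)) by ring.
  by rewrite uv mul1r.
exists ((c'`_0)^-1 *: g') => //.
have [->|g0] := eqVneq g' 0; first by rewrite scaler0 size_poly0.
rewrite Eq size_mul ?scaler_eq0 ?invr_eq0 ?negb_or ?d0 //.
by move: c0; rewrite -size_poly_gt0; clear; slia.
Qed.

(** For slope [m >= 0], [c = m (x - r) + c(r)] with [c(r) >= 0], so [m w] serves as [S1]; for
    negative slope [r'] and [w'] are used. Since [c] is nonnegative at [r] and [r'], the root of a
    nonconstant [c] lies outside the open interval between them, where [q >= 0]. *)
Lemma nonneg_linear_certificate : exists D, forall c : {poly R}, (size c <= 2)%N ->
  (forall x, q.[x] <= 0 -> 0 <= c.[x]) ->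
  exists p1 p2 b1 b2 : {poly R},
    [/\ c = p1 ^+ 2 + p2 ^+ 2 - q * (b1 ^+ 2 + b2 ^+ 2),
        (size p1 <= D)%N /\ (size p2 <= D)%N,
        (size b1 <= D)%N /\ (size b2 <= D)%N &
        forall x, root c x -> (size c <= 1)%N || (0 <= q.[x])].
Proof.
have [r [r' [w [w' [rr' [qr qr'] Hw Hw' qpos]]]]] := end_certificates qm q5 qS q_neg.
exists (maxn (size w) (size w') + 6)%N => c sc cpos.
have Ec : c = c`_1 *: 'X + (c`_0)%:P.
  apply/polyP => k; rewrite coefD coefZ coefX coefC.
  case: k => [|[|k]] /=; rewrite ?mulr0 ?mulr1 ?add0r ?addr0 //.
  exact/(leq_sizeP _ _ sc).
have cE x : c.[x] = c`_1 * x + c`_0 by rewrite {1}Ec !hornerE.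
have cr : 0 <= c`_1 * r + c`_0 by rewrite -cE cpos ?qr.
have cr' : 0 <= c`_1 * r' + c`_0 by rewrite -cE cpos ?qr'.
have [S1 sS1 [S1pos S0pos]] : exists2 S1 : {poly R},
    (size S1 <= maxn (size w) (size w'))%N &
    (forall x, 0 <= S1.[x]) /\ (forall x, 0 <= (c + q * S1).[x]).
  have [c1|c1] := lerP 0 c`_1.
    exists (c`_1 *: w); first by rewrite (leq_trans (size_scale_leq _ _)) ?leq_maxl.
    split=> x; have [H1 H2] := Hw x; first by rewrite hornerZ mulr_ge0.
    move: H2; rewrite !(hornerD, hornerN, hornerM, hornerZ, hornerX, hornerC) cE.
    move=> H2; have := mulr_ge0 c1 H2; lra.
  exists (- c`_1 *: w').
    by rewrite (leq_trans (size_scale_leq _ _)) ?leq_maxr.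
  have c1' : 0 <= - c`_1 by lra.
  split=> x; have [H1 H2] := Hw' x; first by rewrite hornerZ mulr_ge0.
  move: H2; rewrite !(hornerD, hornerN, hornerM, hornerZ, hornerX, hornerC) cE.
  move=> H2; have := mulr_ge0 c1' H2; lra.
have [p1 [p2 Ep]] := nonneg_sum_two_squares S0pos.
have [b1 [b2 Eb]] := nonneg_sum_two_squares S1pos.
exists p1, p2, b1, b2; split.
- by rewrite -Ep -Eb addrK.
- apply: size_two_squares; rewrite -Ep; apply: size_add_bound.
    by rewrite (leq_trans sc) // addnS addnS ltnS ltnS.
  rewrite (leq_trans (size_polyMleq _ _)) // q5.
  by move: sS1; move: (maxn _ _) => m; clear; slia.
- by apply: size_two_squares; rewrite -Eb (leq_trans sS1) // leq_addr.
- move=> x; rewrite rootE cE => /eqP cx.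
  have [c1|c1|c1] := ltrgtP 0 c`_1.
  + by rewrite qpos ?orbT //; left; nra.
  + by rewrite qpos ?orbT //; right; nra.
  + by rewrite Ec -c1 scale0r add0r size_polyC_leq1.
Qed.

(** Here [a + b y = |F|^2 / c]. For constant [c] the real and imaginary parts of [F / sqrt c]
    suffice. Otherwise [1 / c = (|k1|^2 + |k2|^2) / c ^+ 2], and the point is that [c] divides each
    [F kj]. *)
Lemma sos_of_abs_multiple : exists D, forall a b c f1 f2 h1 h2 n,
  (size f1 <= n.+2)%N -> (size f2 <= n.+2)%N ->
  (size h1 <= n)%N -> (size h2 <= n)%N ->
  a * c = absR q f1 f2 h1 h2 -> b * c = absI f1 f2 h1 h2 ->
  c != 0 -> (size c <= 2)%N -> (forall x, q.[x] <= 0 -> 0 <= c.[x]) ->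
  sos_le q (n + D) a b.
Proof.
have [D HD] := nonneg_linear_certificate.
exists (D.*2.+1 + 8)%N => a b c f1 f2 h1 h2 n sf1 sf2 sh1 sh2 Ea Eb c0 sc cpos.
have dleI g h : (size g <= n + D.*2.+1 + 8)%N ->
    (size h <= n + D.*2.+1 + 6)%N -> dle (n + (D.*2.+1 + 8)) g h.
  move=> sg sh; apply/andP; split.
    by rewrite addnA (leq_trans sg).
  have [->|h0] := eqVneq h 0; first by rewrite mulr0 size_poly0.
  rewrite size_XnM //; move: sh; clear; slia.
have [sc1|sc1] := leqP (size c) 1.
  have Ec := size1_polyC sc1; set k := c`_0 in Ec.
  have [x0 /ltW qx0] := q_neg.
  have k0 : 0 < k.
    rewrite lt_neqAle eq_sym -polyC_eq0 -Ec c0 /=.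
    by have := cpos x0 qx0; rewrite Ec hornerC.
  pose v := (Num.sqrt k)^-1; have v2 : v ^+ 2 * k = 1.
    by rewrite exprVn sqr_sqrtr ?ltW // mulVf // gt_eqF.
  have vP : v%:P ^+ 2 * c = 1 by rewrite Ec -rmorphXn -rmorphM /= v2.
  exists [:: (v%:P * f1, v%:P * h1); (v%:P * f2, v%:P * h2)].
    have B (g : {poly R}) m m' : (size g <= m)%N -> (m <= m')%N ->
        (size (v%:P * g)%R <= m')%N.
      by move=> H1 H2; rewrite mul_polyC (leq_trans (size_scale_leq _ _)) // (leq_trans H1).
    by rewrite /= !dleI //; apply: B; eassumption || (clear; lia).
  rewrite !big_cons !big_nil /= !addr0; split.
    have -> : (v%:P * f1) ^+ 2 - q * (v%:P * h1) ^+ 2 +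
      ((v%:P * f2) ^+ 2 - q * (v%:P * h2) ^+ 2) = v%:P ^+ 2 * absR q f1 f2 h1 h2.
      by rewrite /absR; ring.
    by rewrite -Ea mulrCA vP mulr1.
  have -> : 2%:R * (v%:P * f1 * (v%:P * h1)) + 2%:R * (v%:P * f2 * (v%:P * h2)) =
            v%:P ^+ 2 * absI f1 f2 h1 h2.
    by rewrite /absI; ring.
  by rewrite -Eb mulrCA vP mulr1.
have [p1 [p2 [b1 [b2 [Ec [sp1 sp2] [sb1 sb2] qpos]]]]] := HD c sc cpos.
have [x cx] : exists x, root c x.
  have s2 : size c = 2%N by apply/eqP; rewrite eqn_leq sc.
  by have [x rx] := poly2_root s2; exists x.
have qx : 0 <= q.[x] by have := qpos x cx; rewrite leqNgt sc1.
have cx0 := rootP cx.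
have ER := congr1 (fun p => p.[x]) Ea; have EI := congr1 (fun p => p.[x]) Eb.
have h2x : (2%:R : {poly R}).[x] = 2 by rewrite !hornerE.
rewrite /absR !(hornerD, hornerN, hornerM, horner_exp) cx0 mulr0 in ER.
rewrite /absI hornerM cx0 mulr0 hornerM h2x hornerD !hornerM in EI.
(* Both components of [|F|^2] vanish at [x], which makes [F] vanish at the point over [x] with
   [y = - i s]. *)
have [s [s2 e1 e2]] : exists s, [/\ s ^+ 2 = q.[x],
   f1.[x] = - (s * h2.[x]) & f2.[x] = s * h1.[x]].
  apply: sqrt_of_ratio => //; first by apply/eqP; rewrite -subr_eq0 -ER.
  by apply/eqP; move/esym/eqP: EI; rewrite mulf_eq0 pnatr_eq0.
(* The rotation makes each [kj] vanish at the conjugate point [y = i s]. *)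
have [r1 [r2 [Er r1x r2x]]] : exists r1 r2, [/\ r1 ^+ 2 + r2 ^+ 2 = p1 ^+ 2 + p2 ^+ 2,
    r1.[x] = s * b1.[x] & r2.[x] = s * b2.[x]].
  apply: rotate_to; have := congr1 (fun p => p.[x]) Ec.
  by rewrite !(hornerD, hornerN, hornerM, horner_exp) cx0 -s2; lra.
have [sr1 sr2] : (size r1 <= D.*2.+1)%N /\ (size r2 <= D.*2.+1)%N.
  apply: size_two_squares; rewrite Er; apply: size_add_bound;
    rewrite expr2 (leq_trans (size_polyMleq _ _)) //; move: sp1 sp2; clear; slia.
have [sb1' sb2'] : (size b1 <= D.*2.+1)%N /\ (size b2 <= D.*2.+1)%N.
  by move: sb1 sb2; clear; split; slia.
have Q (g : {poly R}) : root g x -> exists2 g', g = c * g' & (size g' <= size g)%N.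
  exact: linear_factor_quotient.
pose M := D.*2.+1; rewrite -/M in sr1 sr2 sb1' sb2' dleI *.
have SA f p h b' : (size f <= n.+2)%N -> (size p <= M)%N -> (size h <= n)%N ->
    (size b' <= M)%N -> (size (f * p + h * b' * q)%R <= n + M + 6)%N.
  move=> H1 H2 H3 H4; apply: size_add_bound.
    by rewrite (leq_trans (size_polyMleq _ _)) //; move: H1 H2; clear; slia.
  rewrite (leq_trans (size_polyMleq _ _)) // q5.
  have := size_polyMleq h b'; move: H3 H4; clear; slia.
have SB f p h b' : (size f <= n.+2)%N -> (size p <= M)%N -> (size h <= n)%N ->
    (size b' <= M)%N -> (size (f * b' + h * p)%R <= n + M + 6)%N.
  move=> H1 H2 H3 H4; apply: size_add_bound;
    rewrite (leq_trans (size_polyMleq _ _)) //; move: H1 H2 H3 H4; clear; slia.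
(* [c = |k1|^2 + |k2|^2] with [kj = rj + i bj y], and [c] divides [(f + h y) kj]
   because [rj(x) = s bj(x)] and [f(x) = i s h(x)] at the root [x] of [c]. *)
have quot (r b' : {poly R}) : (size r <= M)%N -> (size b' <= M)%N -> r.[x] = s * b'.[x] ->
  exists A B C E : {poly R}, [/\ dle (n + (M + 8)) A B, dle (n + (M + 8)) C E,
    f1 * r + h2 * b' * q = c * A /\ h1 * r - f2 * b' = c * B &
    f2 * r - h1 * b' * q = c * C /\ f1 * b' + h2 * r = c * E].
  move=> sr sb rx.
  (* [A + B y] and [C + E y] are the real and imaginary parts of [F k / c], where
     [k = r + i b' y]. *)
  have [|A EA sA] := Q (f1 * r + h2 * b' * q).
    by rewrite rootE !(hornerD, hornerN, hornerM) rx e1 -s2; apply/eqP; ring.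
  have [|B EB sB] := Q (h1 * r - f2 * b').
    by rewrite rootE !(hornerD, hornerN, hornerM) rx e2; apply/eqP; ring.
  have [|C EC sC] := Q (f2 * r - h1 * b' * q).
    by rewrite rootE !(hornerD, hornerN, hornerM) rx e2 -s2; apply/eqP; ring.
  have [|E EE sE] := Q (f1 * b' + h2 * r).
    by rewrite rootE !(hornerD, hornerN, hornerM) rx e1; apply/eqP; ring.
  have le8 k : (k <= n + M + 6 -> k <= n + M + 8)%N by clear; lia.
  exists A, B, C, E; split => //; apply: dleI.
  - by apply/le8/(leq_trans sA)/SA.
  - by apply: (leq_trans sB); rewrite addrC -mulNr SB ?size_polyN.
  - by apply/le8/(leq_trans sC); rewrite -!mulNr SA ?size_polyN.
  - by apply: (leq_trans sE); apply: SB.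
have [A1 [B1 [C1 [E1 [dAB1 dCE1 [EA1 EB1] [EC1 EE1]]]]]] := quot r1 b1 sr1 sb1' r1x.
have [A2 [B2 [C2 [E2 [dAB2 dCE2 [EA2 EB2] [EC2 EE2]]]]]] := quot r2 b2 sr2 sb2' r2x.
have Ecr : c = r1 ^+ 2 + r2 ^+ 2 - q * (b1 ^+ 2 + b2 ^+ 2) by rewrite Er.
exists [:: (A1, B1); (C1, E1); (A2, B2); (C2, E2)].
  by rewrite /= dAB1 dCE1 dAB2 dCE2.
(* After multiplication by [c ^+ 2] both sides are components of [|F|^2 (|k1|^2 + |k2|^2)]. *)
have cc0 : c ^+ 2 != 0 by rewrite expf_neq0.
rewrite !big_cons !big_nil /= !addr0; split; apply: (mulfI cc0).
  have -> : c ^+ 2 * a = (a * c) * c by ring.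
  have -> : c ^+ 2 * (A1 ^+ 2 - q * B1 ^+ 2 + (C1 ^+ 2 - q * E1 ^+ 2 +
     (A2 ^+ 2 - q * B2 ^+ 2 + (C2 ^+ 2 - q * E2 ^+ 2)))) =
     (c * A1) ^+ 2 - q * (c * B1) ^+ 2 + ((c * C1) ^+ 2 - q * (c * E1) ^+ 2 +
     ((c * A2) ^+ 2 - q * (c * B2) ^+ 2 + ((c * C2) ^+ 2 - q * (c * E2) ^+ 2))).
    by ring.
  rewrite -EA1 -EB1 -EC1 -EE1 -EA2 -EB2 -EC2 -EE2 Ea Ecr /absR; ring.
have -> : c ^+ 2 * b = (b * c) * c by ring.
have -> : c ^+ 2 * (2%:R * (A1 * B1) + (2%:R * (C1 * E1) + (2%:R * (A2 * B2) +
     2%:R * (C2 * E2)))) =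
     2%:R * (c * A1 * (c * B1)) + (2%:R * (c * C1 * (c * E1)) +
     (2%:R * (c * A2 * (c * B2)) + 2%:R * (c * C2 * (c * E2)))) by ring.
rewrite -EA1 -EB1 -EC1 -EE1 -EA2 -EB2 -EC2 -EE2 Eb Ecr /absI; ring.
Qed.

End LinearMultiple.

(** * Reduction to the coprime case *)

Section Stripping.
Variables (R : archiRcfType) (q : {poly R}).
Hypotheses (qm : q \is monic) (q5 : size q = 5%N) (qS : simple_real_roots q).
Hypothesis q_neg : exists x, q.[x] < 0.
Implicit Types (a b c f h p s : {poly R}) (r : R).

Lemma sos_le_leq e e' a b : (e <= e')%N -> sos_le q e a b -> sos_le q e' a b.
Proof.
move=> ee' [l lP E]; exists l => //; apply: sub_all lP => -[u v] /andP [su sv].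
by apply/andP; split; [move: su|move: sv] => /leq_trans; apply.
Qed.

Lemma sos_leD e a b a' b' : sos_le q e a b -> sos_le q e a' b' ->
  sos_le q e (a + a') (b + b').
Proof.
move=> [l lP [-> ->]] [l' lP' [-> ->]]; exists (l ++ l').
  by rewrite all_cat lP.
by rewrite !big_cat.
Qed.

Lemma sos_le_mulsqr e a b s : (size s <= 2)%N -> sos_le q e a b ->
  sos_le q e.+1 (s ^+ 2 * a) (s ^+ 2 * b).
Proof.
move=> ss [l /allP lP [-> ->]]; exists [seq (s * g.1, s * g.2) | g <- l].
  apply/allP => _ /mapP [[u v] /lP /andP /= [su sv] ->].
  have B p : (size p <= e.+1)%N -> (size (s * p)%R <= e.+2)%N.
    by move=> sp; apply: (@size_mul_bound _ 1 e).
  by rewrite /dle /= mulrCA !B.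
rewrite !big_map !mulr_sumr /=; split; apply: eq_bigr => g _; ring.
Qed.

Lemma dle_bound e d a b : dle d a b -> size (cnorm q a b) = e.*2.+1 -> (e <= d)%N.
Proof.
move=> /andP [sa sb] sN; have : (size ('X^4 * cnorm q a b)%R <= (4 + (d + d)).+1)%N.
  have -> : 'X^4 * cnorm q a b = 'X^4 * (a * a) + q * ('X^2 * b * ('X^2 * b)).
    by rewrite /cnorm; ring.
  apply: size_add_bound; apply: size_mul_bound; rewrite ?size_polyXn ?q5 //;
    exact: size_mul_bound.
rewrite size_XnM -?size_poly_gt0 sN //; clear; lia.
Qed.

Lemma dle_strip d s a b : size s = 3%N -> (a != 0) || (b != 0) ->
  dle d (s * a) (s * b) -> exists2 d', d = d'.+2 & dle d' a b.
Proof.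
move=> s3; have s0 : s != 0 by rewrite -size_poly_gt0 s3.
have S p : p != 0 -> size (s * p) = (size p).+2.
  move=> p0; rewrite size_mul // s3 !addSn.
  by move: p0; rewrite -size_poly_gt0; clear; slia.
have X2 p : p != 0 -> 'X^2 * p != 0.
  by apply: mulf_neq0; rewrite monic_neq0 ?monicXn.
move=> ab0 /andP []; rewrite mulrCA.
case: (eqVneq a 0) ab0 => [->|a0 _] /=; first move=> b0.
  rewrite mulr0 (S _ (X2 _ b0)) => _.
  rewrite size_XnM //= ltnS; case: d => [|[|d]] // sb; exists d => //.
  by rewrite /dle size_poly0 size_XnM.
rewrite S // ltnS; have a1 : (0 < size a)%N by rewrite size_poly_gt0.
case: d => [|[|d]] //; first by rewrite ltnS leqNgt a1.
rewrite ltnS; move=> sa sb; exists d => //; rewrite /dle sa /=.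
have [->|b0] := eqVneq b 0; first by rewrite mulr0 size_poly0.
by move: sb; rewrite (S _ (X2 _ b0)).
Qed.

Lemma psd_cancel_sqr s a b : s != 0 ->
  psd_pair q (s ^+ 2 * a) (s ^+ 2 * b) -> psd_pair q a b.
Proof.
move=> s0 H x qx; split.
  by apply: (nonneg_on_region_cancel qS s0) qx => y /H [].
have s20 : s ^+ 2 != 0 by rewrite expf_neq0.
apply: (nonneg_on_region_cancel qS s20) qx => y /H [_].
by congr (0 <= _.[_]); rewrite /cnorm; ring.
Qed.

(** The sign change of ['X - r%:P] forces a zero of [a]. The norm at [r] is then [b.[r] ^+ 2 *
    q.[r]], nonnegative only if [b] vanishes too. *)
Lemma psd_root_inside r a b : q.[r] < 0 ->
  psd_pair q (('X - r%:P) * a) (('X - r%:P) * b) -> root a r /\ root b r.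
Proof.
move=> qr H; have ra : root a r by apply: (root_of_sign_change qr) => x /H [].
split=> //; have X0 : 'X - r%:P != 0 by rewrite polyXsubC_eq0.
have : 0 <= (cnorm q a b).[r].
  apply: (nonneg_on_region_cancel qS X0) (ltW qr) => y /H [_].
  by congr (0 <= _.[_]); rewrite /cnorm; ring.
rewrite /cnorm !expr2 hornerD !hornerM (rootP ra) mul0r add0r rootE => br.
apply: contraT => b0; have : 0 < b.[r] ^+ 2 by rewrite exprn_even_gt0.
by rewrite expr2; nra.
Qed.

Lemma psd_cancel_pos s a b : (forall x, 0 < s.[x]) ->
  psd_pair q (s * a) (s * b) -> psd_pair q a b.
Proof.
move=> s0 H x /H []; have -> : cnorm q (s * a) (s * b) = s ^+ 2 * cnorm q a b.
  by rewrite /cnorm; ring.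
by rewrite hornerM [(s ^+ 2 * _).[_]]hornerM horner_exp !pmulr_rge0 // exprn_gt0.
Qed.

Lemma sos_le0 e : sos_le q e 0 0.
Proof. by exists [::]; rewrite // !big_nil. Qed.

(** Common zeros of [a] and [b] are removed until the components are coprime. Stripping a quadratic
    lowers [d] by 2, hence [uphalf d] by 1, and multiplying the squares back costs 1, so [D] never
    grows. *)
Lemma psd_sos_bound : exists D, forall a b d, dle d a b -> psd_pair q a b ->
  sos_le q (D + uphalf d) a b.
Proof.
have [D HD] := sos_of_abs_multiple qm q5 qS q_neg.
(* The list [rs] stores the real common zeros that cannot be removed as squares; the induction is on
   the size of the remaining components. *)
exists D; suff K m a b rs d : (size a + size b < m)%N -> uniq rs ->
    {in rs, forall r, 0 <= q.[r]} ->
    dle d (prodX rs * a) (prodX rs * b) -> psd_pair q (prodX rs * a) (prodX rs * b) ->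
    sos_le q (D + uphalf d) (prodX rs * a) (prodX rs * b).
  move=> a b d dab pab; have := K _ a b [::] d (ltnSn _) isT.
  by rewrite /prodX big_nil !mul1r; apply.
elim: m a b rs d => // m IHm a b rs d; rewrite ltnS => sab rsU rs_q dab pab.
have [ab0|] := boolP ((a != 0) || (b != 0)); last first.
  by rewrite negb_or !negbK => /andP [/eqP -> /eqP ->]; rewrite mulr0; apply: sos_le0.
have g0 := prodX_neq0 rs; set g := prodX rs in g0 dab pab *.
have [cop|/closed_rootP [[x y]]] := eqVneq (size (gcdp (toC a) (toC b))) 1%N.
  have abC : coprimeC a b.
    move=> z; apply/negP; rewrite -root_gcd => rz.
    have /closed_rootP : exists z, root (gcdp (toC a) (toC b)) z by exists z.
    by rewrite cop.
  have [e de se] := size_cnorm qm q5 ab0.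
  have [f1 [f2 [h1 [h2 [c [[sf1 sf2 sh1 sh2] Ea Eb [c0 sc] cpos]]]]]] :=
    psd_times_linear_is_abs qm q5 qS q_neg abC rsU rs_q pab de se.
  have := HD _ _ _ _ _ _ _ _ sf1 sf2 sh1 sh2 Ea Eb c0 sc cpos.
  apply: sos_le_leq; rewrite addnC leq_add2l.
  have ed : (e + size rs <= d)%N.
    apply: dle_bound dab _.
    have -> : cnorm q (g * a) (g * b) = cnorm q a b * g ^+ 2 by rewrite /cnorm; ring.
    rewrite size_Mmonic ?monic_exp ?monic_prod_XsubC // -?size_poly_gt0 se //.
    rewrite expr2 size_mul // /g /prodX size_prod_XsubC; clear; slia.
  apply: leq_trans (half_leq ed) _.
  by rewrite uphalf_half leq_addl.
rewrite root_gcd => /andP [ra rb].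
have decr p p' t : p = p' * t -> (1 < size t)%N -> (size p' <= size p)%N /\
    (p != 0 -> (size p' < size p)%N).
  move=> Ep st; have t0 : t != 0 by rewrite -size_poly_gt0 ltnW.
  have [p0|p0] := eqVneq p' 0.
    by rewrite p0 size_poly0 size_poly_gt0.
  have : (size p' < size p)%N.
    rewrite Ep size_mul //; move: st p0; rewrite -size_poly_gt0; clear; slia.
  by move=> H; split=> //; apply: ltnW.
have decr2 a' b' t : a = a' * t -> b = b' * t -> (1 < size t)%N ->
    (size a' + size b' < m)%N.
  move=> /decr Ha /decr Hb st; have [Ha1 Ha2] := Ha st; have [Hb1 Hb2] := Hb st.
  apply: leq_trans sab; case/orP: ab0 => [/Ha2|/Hb2] H.
    by rewrite -addSn leq_add.
  by rewrite -addnS leq_add.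
have nz a' b' t : a = t * a' -> b = t * b' -> (a' != 0) || (b' != 0).
  move=> Ea Eb; apply: contraTT ab0; rewrite !negb_or !negbK.
  by move=> /andP [/eqP a'0 /eqP b'0]; rewrite Ea Eb a'0 b'0 mulr0 eqxx.
(* A nonreal common zero gives a positive factor [(X - x)^2 + y^2], which splits the element into
   two multiples by squares. *)
have [y0|y0] := eqVneq y 0; last first.
  have [a' Ea] := dvdpP _ _ (quadratic_dvdp y0 ra).
  have [b' Eb] := dvdpP _ _ (quadratic_dvdp y0 rb).
  set t := _ + _ in Ea Eb; have st : size t = 3%N := size_quadratic _ _.
  have tpos z : 0 < t.[z].
    rewrite /t !hornerE /= ltr_wpDl ?sqr_ge0 //.
    by rewrite exprn_even_gt0.
  have tE p : g * (p * t) = t * (g * p) by ring.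
  rewrite Ea Eb !tE in dab pab *.
  have gab0 : (g * a' != 0) || (g * b' != 0).
    by rewrite !mulf_eq0 (negbTE g0) /=; apply: (nz _ _ t); rewrite mulrC.
  have [d' Ed dab'] := dle_strip st gab0 dab.
  have H : sos_le q (D + uphalf d') (g * a') (g * b').
    apply: IHm => //; first by apply: (decr2 _ _ t); rewrite ?st.
    exact: psd_cancel_pos tpos pab.
  have tD p : t * p = ('X - x%:P) ^+ 2 * p + y%:P ^+ 2 * p.
    by rewrite -mulrDl -rmorphXn.
  rewrite !tD Ed /= addnS; apply: sos_leD; apply: sos_le_mulsqr => //.
    by rewrite size_XsubC.
  by rewrite (leq_trans (size_polyC_leq1 _)).
move: ra rb; rewrite {}y0 complexr0 !rootE !toC_horner !eq_complex /= eqxx !andbT.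
move=> /factor_theorem [a1 Ea] /factor_theorem [b1 Eb].
have X0 : 'X - x%:P != 0 by rewrite polyXsubC_eq0.
have sX2 : size (('X - x%:P) ^+ 2) = 3%N by rewrite size_exp_XsubC.
have strip rs' a' b' : prodX rs' != 0 -> uniq rs' -> {in rs', forall r, 0 <= q.[r]} ->
    g * a = ('X - x%:P) ^+ 2 * (prodX rs' * a') ->
    g * b = ('X - x%:P) ^+ 2 * (prodX rs' * b') ->
    (a' != 0) || (b' != 0) -> (size a' + size b' < m)%N ->
    sos_le q (D + uphalf d) (g * a) (g * b).
  move=> g'0 rsU' rs_q' Ega Egb ab0' sab'; rewrite Ega Egb in dab pab *.
  have gab0 : (prodX rs' * a' != 0) || (prodX rs' * b' != 0).
    by rewrite !mulf_eq0 (negbTE g'0).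
  have [d' Ed dab'] := dle_strip sX2 gab0 dab.
  rewrite Ed /= addnS; apply: sos_le_mulsqr; first by rewrite size_XsubC.
  by apply: IHm => //; apply: psd_cancel_sqr X0 pab.
have sa1 : (size a1 + size b1 < m)%N by apply: (decr2 _ _ ('X - x%:P)); rewrite ?size_XsubC.
have nz1 : (a1 != 0) || (b1 != 0) by apply: (nz _ _ ('X - x%:P)); rewrite mulrC.
(* A real zero already stored in [rs] completes a square. *)
have [xrs|xrs] := boolP (x \in rs).
  have Eg : g = ('X - x%:P) * prodX (rem x rs).
    by rewrite /g /prodX (perm_big _ (perm_to_rem xrs)) big_cons.
  apply: (strip (rem x rs) a1 b1) => //.
  - exact: prodX_neq0.
  - exact: rem_uniq.
  - by move=> r /mem_rem /rs_q.
  - by rewrite Ea Eg; ring.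
  - by rewrite Eb Eg; ring.
(* A new zero with [q >= 0] is moved into [rs]; one with [q < 0] must occur a second time, which
   again gives a square. *)
have [qx|qx] := lerP 0 q.[x].
  have Eg p : g * (p * ('X - x%:P)) = prodX (x :: rs) * p.
    by rewrite /g /prodX big_cons; ring.
  rewrite Ea Eb !Eg in dab pab *; apply: IHm => //=; first by rewrite xrs.
  by move=> r; rewrite inE => /orP [/eqP -> //|/rs_q].
have Eg p : g * (p * ('X - x%:P)) = ('X - x%:P) * (g * p) by ring.
have [ra rb] : root (g * a1) x /\ root (g * b1) x.
  by apply: (psd_root_inside qx); rewrite -!Eg -Ea -Eb.
have gx : ~~ root g x by rewrite /g /prodX root_prod_XsubC.
move: ra rb; rewrite !rootM (negbTE gx) /=.
move=> /factor_theorem [a2 Ea2] /factor_theorem [b2 Eb2].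
apply: (strip rs a2 b2) => //.
- by rewrite Ea Ea2 -/g; ring.
- by rewrite Eb Eb2 -/g; ring.
- by apply: (nz _ _ (('X - x%:P) ^+ 2)); rewrite ?Ea ?Ea2 ?Eb ?Eb2; ring.
- apply: (decr2 _ _ (('X - x%:P) ^+ 2)); rewrite ?sX2 //.
    by rewrite Ea Ea2; ring.
  by rewrite Eb Eb2; ring.
Qed.

End Stripping.

(** * Coefficient lists *)

Section Lists.
Local Notation RR := Rdefinitions.R.
Implicit Types (p r q : rpoly) (x : RR).

Definition toP (p : rpoly) : {poly RR} := Poly p.
Arguments toP : simpl never.

Lemma coef_toP p i : (toP p)`_i = coef p i.
Proof. by rewrite coef_Poly /coef; elim: p i => [|c p IHp] [|i] //=. Qed.

Lemma toP_cons c p : toP (c :: p) = c%:P + 'X * toP p.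
Proof. by rewrite /toP /= cons_poly_def mulrC addrC. Qed.

Lemma peqP p r : peq p r <-> toP p = toP r.
Proof.
split=> [H|H i]; last by rewrite -!coef_toP H.
by apply/polyP => i; rewrite !coef_toP H.
Qed.

Lemma peval_toP p x : peval p x = (toP p).[x].
Proof.
elim: p => [|c p IHp]; first by rewrite /toP horner0.
by rewrite toP_cons /= IHp !hornerE.
Qed.

Lemma toP_padd p r : toP (padd p r) = toP p + toP r.
Proof.
elim: p r => [|c p IHp] [|d r] //=; rewrite ?add0r ?addr0 //.
by rewrite !toP_cons IHp polyCD; ring.
Qed.

Lemma toP_pscale c p : toP (pscale c p) = c%:P * toP p.
Proof.
elim: p => [|d p IHp]; first by rewrite /toP mulr0.
by rewrite /pscale /= !toP_cons -/(pscale c p) IHp RmultE polyCM; ring.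
Qed.

Lemma toP_popp p : toP (popp p) = - toP p.
Proof.
elim: p => [|d p IHp]; first by rewrite /toP oppr0.
by rewrite /popp /= !toP_cons -/(popp p) IHp RoppE polyCN; ring.
Qed.

Lemma toP_pmul p r : toP (pmul p r) = toP p * toP r.
Proof.
elim: p => [|c p IHp] /=; first by rewrite /toP mul0r.
by rewrite toP_padd toP_pscale !toP_cons IHp R0E polyC0; ring.
Qed.

Lemma pdeg_toP p : pdeg p = if size (toP p) is n.+1 then Some n else None.
Proof.
elim: p => [|c p IHp] //=; first by rewrite /toP size_poly0.
rewrite IHp /toP /= size_cons_poly nil_poly -size_poly_eq0.
case E : (size (Poly p)) => [|n] //=.
case: Req_dec_T => c0; first by have -> : c == 0 by apply/eqP.
by have /negbTE -> : c != 0 by apply/eqP.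
Qed.

Lemma toP_polyseq (u : {poly RR}) : toP (polyseq u) = u.
Proof. exact: polyseqK. Qed.

Lemma delta_leP (f : CR) d : delta_le f d <-> dle d (toP f.1) (toP f.2).
Proof.
rewrite /delta_le /delta !pdeg_toP /dle.
have [->|b0] := eqVneq (toP f.2) 0.
  rewrite mulr0 !size_poly0 /= andbT; case: (size _) => [|n] //=.
  by rewrite ltnS; split=> /ssrnat.leP.
rewrite size_XnM //; have := b0; rewrite -size_poly_gt0.
case: (size (toP f.2)) => [//|n] _ /=; case: (size _) => [|m] /=.
  by rewrite !plusE; split; [move/ssrnat.leP; lia|move=> H; apply/ssrnat.leP; lia].
rewrite !plusE; split; first by move/ssrnat.leP; lia.
by move=> H; apply/ssrnat.leP; lia.
Qed.

Lemma pevalC_real p x : pevalC p (x, 0) = (peval p x, 0).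
Proof.
elim: p => [//|c p IHp] /=; rewrite IHp /zadd /zmul /=.
by congr pair; rewrite ?(RplusE, RminusE, RmultE, R0E); ring.
Qed.

Lemma toP_pderiv p : toP (pderiv p) = (toP p)^`().
Proof.
case: p => [|c p]; first by rewrite /toP deriv0.
apply/polyP => i; rewrite coef_deriv !coef_toP /= /coef /=.
suff H n : List.nth i (pderiv_aux n p) 0%R = List.nth i p 0%R *+ (n + i).
  by rewrite H.
elim: p n i => [|d p IHp] n [|i] //=; rewrite ?mul0rn //.
  by rewrite addn0 RmultE INRE mulr_natl.
by rewrite IHp addSnnS.
Qed.

Lemma sum_sq_toP q (l : seq ({poly RR} * {poly RR})) :
  let f := sum_sq q [seq (polyseq g.1, polyseq g.2) | g <- l] in
  toP f.1 = \sum_(g <- l) (g.1 ^+ 2 - toP q * g.2 ^+ 2) /\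
  toP f.2 = \sum_(g <- l) 2%:R * (g.1 * g.2).
Proof.
elim: l => [|g l [IH1 IH2]] /=; first by rewrite !big_nil.
rewrite !big_cons -IH1 -IH2.
rewrite !(toP_padd, toP_pmul, toP_popp, toP_polyseq); split; ring.
Qed.

(** The values at the two points [(x, y)] and [(x, - y)] are nonnegative; their sum is [2 a(x)] and
    their product is the norm. *)
Lemma psd_pair_of_psd (q : rpoly) (f : CR) : psd q f ->
  psd_pair (toP q) (toP f.1) (toP f.2).
Proof.
move=> fpsd x qx; set a := (toP f.1).[x]; set b := (toP f.2).[x].
pose y := Num.sqrt (- (toP q).[x]).
have y2 : y * y = - (toP q).[x] by rewrite -expr2 sqr_sqrtr ?oppr_ge0.
have H z : z * z = - (toP q).[x] -> 0 <= a + b * z.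
  move=> z2; have : Rle 0 (ceval f x z).
    by apply: fpsd; rewrite peval_toP RplusE RmultE z2 addNr.
  by move/RleP; rewrite /ceval !peval_toP.
have Hy := H y y2; have HNy : 0 <= a + b * - y by apply: H; rewrite mulrNN.
split; first by lra.
rewrite /cnorm !expr2 hornerD !hornerM -/a -/b.
have := mulr_ge0 Hy HNy.
have -> : (a + b * y) * (a + b * - y) = a * a - b * b * (y * y) by ring.
by rewrite y2 mulrN opprK.
Qed.

Lemma sos_le_sos_bound (q : rpoly) (f : CR) e :
  sos_le (toP q) e (toP f.1) (toP f.2) -> sos_bound q f e.
Proof.
move=> [l lP [E1 E2]]; exists [seq (polyseq g.1, polyseq g.2) | g <- l]; split.
  elim: l lP {E1 E2} => [|g l IHl] /=; first by constructor.
  move=> /andP [gP lP]; constructor; last exact: IHl.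
  by apply/delta_leP; rewrite /= !toP_polyseq.
have [S1 S2] := sum_sq_toP q l.
by split; apply/peqP; rewrite ?S1 ?S2.
Qed.

Lemma uphalf_div d : uphalf d = Nat.div (d + 1) 2.
Proof.
apply: (Nat.div_unique _ _ _ (~~ odd d)); first by apply/ssrnat.ltP; case: odd.
by rewrite plusE multE; have := odd_double_half d; rewrite uphalf_half; case: odd => /=; lia.
Qed.

Lemma psd_sos_bound_lists (q : rpoly) :
  monic_quartic q -> indefinite q -> no_multiple_roots q ->
  exists N, Peano.le 1 N /\ forall f, psd q f -> forall d, delta f = Some d ->
    sos_bound q f (Nat.add N (Nat.div (Nat.add d 1) 2)).
Proof.
move=> [q5 q4] [_ [x0 qx0]] qnm.
have s5 : size (toP q) = 5%N.
  apply/eqP; rewrite eqn_leq; apply/andP; split.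
    by rewrite (leq_trans (size_Poly _)) // -q5.
  rewrite ltnNge; apply/negP => /leq_sizeP /(_ 4%N (leqnn _)).
  by rewrite coef_toP q4 => /eqP; rewrite R1E oner_eq0.
have qm : toP q \is monic by rewrite monicE lead_coefE s5 coef_toP q4.
have qS : simple_real_roots (toP q).
  move=> x /rootP qx; apply/negP => /rootP dqx.
  by apply: (qnm (x, 0%R)); rewrite !pevalC_real !peval_toP toP_pderiv qx dqx.
have q_neg : exists x, (toP q).[x] < 0.
  by exists x0; apply/RltP; rewrite -peval_toP.
have [N HN] := psd_sos_bound qm s5 qS q_neg.
(* The successor secures [1 <= N]. *)
exists N.+1; split; first by apply/ssrnat.leP.
move=> f /psd_pair_of_psd fpsd d fd; apply: sos_le_sos_bound.
rewrite -uphalf_div plusE addSn; apply: sos_le_leq (leqnSn _) _.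
by apply: HN => //; apply/delta_leP; rewrite /delta_le fd.
Qed.

End Lists.

End PsdOnCurve.

Theorem theorem2p13 (q : rpoly)
  (Hq : monic_quartic q) (Hind : indefinite q) (Hsf : no_multiple_roots q) :
  exists N : nat, (1 <= N)%nat /\
    forall f : CR, psd q f ->
      forall d : nat, delta f = Some d ->
        sos_bound q f (N + (d + 1) / 2)%nat.
Proof.
exact (PsdOnCurve.psd_sos_bound_lists Hq Hind Hsf).
Qed.
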